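(* Let $n\ge1$, let $l>1$ and let $q\in\mathbb{C}^*$ be a primitive $l$-th root of unity. Let $a_1,\dots,a_n,b_1,\dots,b_n\in\mathbb{C}$ and let $\mathfrak{m}=(x_1^l-a_1,\dots,x_n^l-a_n,\partial_1^l-b_1,\dots,\partial_n^l-b_n)$, a maximal ideal of the center $Z^q_n$ of $A^q_n$. Then $\mathfrak{m}\in \mathrm{AL}(A^q_n)$ if and only if $a_ib_i\ne (1-q)^{-l}$ for all $1\le i\le n$.
   Context: For $q\in\mathbb{C}^*$ and $n\ge 1$, $A^q_n$ is the $\mathbb{C}$-algebra generated by $x_1,\dots,x_n,\partial_1,\dots,\partial_n$ with relations $\partial_i x_j-q^{\delta_{ij}}x_j\partial_i=\delta_{ij}$, $x_ix_j=x_jx_i$, $\partial_i\partial_j=\partial_j\partial_i$ for $1\le i,j\le n$. When $q$ is a primitive $l$-th root of unity with $l>1$, the center of $A^q_n$ is the polynomial ring $Z^q_n=\mathbb{C}[x_1^l,\dots,x_n^l,\partial_1^l,\dots,\partial_n^l]$, and $A^q_n$ is free of rank $l^{2n}$ over $Z^q_n$. For a $\mathbb{C}$-algebra $A$ that is free of rank $N^2$ over its center $Z$, with $Z$ a finitely generated $\mathbb{C}$-algebra, the Azumaya locus is $\mathrm{AL}(A)=\{\mathfrak{m}\in\max(Z): A/(\mathfrak{m})\cong M_N(\mathbb{C})\}$, where $\max(Z)$ is the set of maximal ideals of $Z$ and $(\mathfrak m)=A\mathfrak m$. For $A=A^q_n$ one has $N=l^n$. *)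

(* Defs.v *)
From HB Require Import structures.
From mathcomp Require Import all_boot all_algebra generic_quotient ring_quotient.
From mathcomp Require Import boolp classical_sets finmap monalg.

Set Implicit Arguments.
Unset Strict Implicit.
Unset Printing Implicit Defensive.

Import GRing.Theory.

Local Open Scope ring_scope.
Local Open Scope classical_set_scope.
Local Open Scope quotient_scope.

Section TwoSidedIdeal.
Variables (K : pzRingType) (A : algType K) (S : set A).

(* the two-sided ideal generated by S *)
Definition gen_ideal : set A :=
  [set a | exists2 t : seq (A * A * A),
     (forall p, p \in t -> S p.1.2) & a = \sum_(p <- t) p.1.1 * p.1.2 * p.2].

Lemma gen_ideal_incl a : S a -> gen_ideal a.
Proof.
move=> Sa; exists [:: (1, a, 1)]; first by move=> p; rewrite inE => /eqP ->.
by rewrite big_seq1 mul1r mulr1.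
Qed.

Lemma gen_ideal0 : gen_ideal 0.
Proof. by exists [::]; rewrite // big_nil. Qed.

Lemma gen_idealD a b : gen_ideal a -> gen_ideal b -> gen_ideal (a + b).
Proof.
move=> [s Ss ->] [t St ->]; exists (s ++ t); last by rewrite big_cat.
by move=> p; rewrite mem_cat => /orP[/Ss|/St].
Qed.

Lemma gen_idealM x a y : gen_ideal a -> gen_ideal (x * a * y).
Proof.
move=> [s Ss ->]; exists [seq (x * p.1.1, p.1.2, p.2 * y) | p <- s].
  by move=> _ /mapP[p /Ss Sp ->].
rewrite big_map mulr_sumr mulr_suml; apply: eq_bigr => p _.
by rewrite !mulrA.
Qed.

Lemma gen_idealMl x a : gen_ideal a -> gen_ideal (x * a).
Proof. by move=> /(gen_idealM x 1); rewrite mulr1. Qed.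

Lemma gen_idealMr a y : gen_ideal a -> gen_ideal (a * y).
Proof. by move=> /(gen_idealM 1 y); rewrite mul1r. Qed.

Definition gen_ideal_pred : A -> bool := fun a => `[< gen_ideal a >].

Lemma gen_ideal_zmod_closed : zmod_closed gen_ideal_pred.
Proof.
split=> [|a b]; first exact/asboolP/gen_ideal0.
move=> /asboolP Ia /asboolP Ib; apply/asboolP/gen_idealD => //.
by rewrite -mulN1r; apply: gen_idealMl.
Qed.

HB.instance Definition _ :=
  GRing.isZmodClosed.Build A gen_ideal_pred gen_ideal_zmod_closed.

Definition gen_ideal_zmodClosed : zmodClosed A :=
  GRing.ZmodClosed.clone A gen_ideal_pred _.

End TwoSidedIdeal.

Section QuotientAlgebra.
Variables (K : pzRingType) (A : algType K) (S : set A).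

(* A / (S); since (S) may be all of A, this is only a pzRingType and a
   lmodType, with quot_scalerAl and quot_scalerAr below *)
Definition quot_alg : Type := Quotient.quot (gen_ideal_zmodClosed S).

HB.instance Definition _ := GRing.Zmodule.on quot_alg.
HB.instance Definition _ := EqQuotient.on quot_alg.

Definition quot_pi (a : A) : quot_alg := \pi_quot_alg a.

Lemma quot_pi_eq a b : quot_pi a = quot_pi b <-> gen_ideal S (a - b).
Proof.
rewrite /quot_pi; split=> [/eqP|Iab].
  by rewrite -Quotient.idealrBE => /asboolP.
by apply/eqP; rewrite -Quotient.idealrBE; apply/asboolP.
Qed.

Lemma quot_piK (u : quot_alg) : quot_pi (repr u) = u.
Proof. exact: reprK. Qed.

Lemma quot_piB a b : quot_pi (a - b) = quot_pi a - quot_pi b.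
Proof. exact: (@raddfB _ (Quotient.quot (gen_ideal_zmodClosed S)) \pi). Qed.

Lemma quot_piD a b : quot_pi (a + b) = quot_pi a + quot_pi b.
Proof. exact: (@raddfD _ (Quotient.quot (gen_ideal_zmodClosed S)) \pi). Qed.

Lemma quot_pi0 : quot_pi 0 = 0.
Proof. by rewrite -[X in quot_pi X](subrr 0) quot_piB subrr. Qed.

Fact quot_key : unit. Proof. by []. Qed.

Definition quot_one : quot_alg := quot_pi 1.
Definition quot_mul : quot_alg -> quot_alg -> quot_alg :=
  locked_with quot_key (fun u v => quot_pi (repr u * repr v)).
Definition quot_scale : K -> quot_alg -> quot_alg :=
  locked_with quot_key (fun k u => quot_pi (k *: repr u)).

Lemma quot_mulE a b : quot_mul (quot_pi a) (quot_pi b) = quot_pi (a * b).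
Proof.
rewrite /quot_mul locked_withE; apply/quot_pi_eq; set a' := repr _; set b' := repr _.
have Ia : gen_ideal S (a' - a) by apply/quot_pi_eq; rewrite quot_piK.
have Ib : gen_ideal S (b' - b) by apply/quot_pi_eq; rewrite quot_piK.
have -> : a' * b' - a * b = (a' - a) * b' + a * (b' - b).
  by rewrite mulrBl mulrBr addrA subrK.
by apply: gen_idealD; [apply: gen_idealMr | apply: gen_idealMl].
Qed.

Lemma quot_scaleE k a : quot_scale k (quot_pi a) = quot_pi (k *: a).
Proof.
rewrite /quot_scale locked_withE; apply/quot_pi_eq; set a' := repr _.
have Ia : gen_ideal S (a' - a) by apply/quot_pi_eq; rewrite quot_piK.
by rewrite -scalerBr -[a' - a]mul1r scalerAl; apply: gen_idealMl.
Qed.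

Lemma quot_ind (P : quot_alg -> Prop) :
  (forall a, P (quot_pi a)) -> forall u, P u.
Proof. by move=> IH u; rewrite -[u]quot_piK. Qed.

Lemma quot_mulA : associative quot_mul.
Proof.
elim/quot_ind=> a; elim/quot_ind=> b; elim/quot_ind=> c.
by rewrite !quot_mulE mulrA.
Qed.

Lemma quot_mul1 : left_id quot_one quot_mul.
Proof. by elim/quot_ind=> a; rewrite quot_mulE mul1r. Qed.

Lemma quot_mulr1 : right_id quot_one quot_mul.
Proof. by elim/quot_ind=> a; rewrite quot_mulE mulr1. Qed.

Lemma quot_mulDl : left_distributive quot_mul +%R.
Proof.
elim/quot_ind=> a; elim/quot_ind=> b; elim/quot_ind=> c.
by rewrite -quot_piD !quot_mulE -quot_piD mulrDl.
Qed.

Lemma quot_mulDr : right_distributive quot_mul +%R.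
Proof.
elim/quot_ind=> a; elim/quot_ind=> b; elim/quot_ind=> c.
by rewrite -quot_piD !quot_mulE -quot_piD mulrDr.
Qed.

HB.instance Definition _ := GRing.Zmodule_isPzRing.Build quot_alg
  quot_mulA quot_mul1 quot_mulr1 quot_mulDl quot_mulDr.

Lemma quot_scaleA j k u : quot_scale j (quot_scale k u) = quot_scale (j * k) u.
Proof. by elim/quot_ind: u => a; rewrite !quot_scaleE scalerA. Qed.

Lemma quot_scale1 : left_id 1 quot_scale.
Proof. by elim/quot_ind=> a; rewrite quot_scaleE scale1r. Qed.

Lemma quot_scaleDr : right_distributive quot_scale +%R.
Proof.
move=> k; elim/quot_ind=> a; elim/quot_ind=> b.
by rewrite -quot_piD !quot_scaleE -quot_piD scalerDr.
Qed.

Lemma quot_scaleDl u : {morph quot_scale^~ u : j k / j + k}.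
Proof.
elim/quot_ind: u => a j k.
by rewrite !quot_scaleE -quot_piD scalerDl.
Qed.

HB.instance Definition _ := GRing.Zmodule_isLmodule.Build K quot_alg
  quot_scaleA quot_scale1 quot_scaleDr quot_scaleDl.

Lemma quot_pi1 : quot_pi 1 = 1.
Proof. by []. Qed.

Lemma quot_piM a b : quot_pi (a * b) = quot_pi a * quot_pi b.
Proof. by rewrite -quot_mulE. Qed.

Lemma quot_piZ k a : quot_pi (k *: a) = k *: quot_pi a.
Proof. by rewrite -quot_scaleE. Qed.

Lemma quot_scalerAl k (u v : quot_alg) : k *: (u * v) = (k *: u) * v.
Proof.
elim/quot_ind: u => a; elim/quot_ind: v => b.
by rewrite -quot_piZ -!quot_piM -quot_piZ scalerAl.
Qed.

Lemma quot_scalerAr k (u v : quot_alg) : k *: (u * v) = u * (k *: v).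
Proof.
elim/quot_ind: u => a; elim/quot_ind: v => b.
by rewrite -quot_piZ -!quot_piM -quot_piZ scalerAr.
Qed.

End QuotientAlgebra.

Section Center.
Variables (K : pzRingType) (A : algType K).

Definition center : set A := [set z | forall a, z * a = a * z].

(* ideals of the commutative ring center are represented as subsets of A *)
Definition center_ideal (I : set A) : Prop :=
  [/\ I `<=` center, I 0, forall u v, I u -> I v -> I (u + v)
    & forall z u, center z -> I u -> I (z * u)].

Definition center_max_ideal (m : set A) : Prop :=
  [/\ center_ideal m, m <> center
    & forall J, center_ideal J -> m `<=` J -> J = m \/ J = center].

(* the ideal of center generated by G, for G inside the center *)
Definition center_gen_ideal (G : set A) : set A :=
  [set u | exists2 t : seq (A * A),
     (forall p, p \in t -> center p.1 /\ G p.2) & u = \sum_(p <- t) p.1 * p.2].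

(* for m inside the center, the two-sided ideal (m) is A m *)
Lemma gen_ideal_center (m : set A) a : m `<=` center ->
  gen_ideal m a <-> exists2 t : seq (A * A),
    (forall p, p \in t -> m p.2) & a = \sum_(p <- t) p.1 * p.2.
Proof.
move=> mZ; split=> -[t mt ->].
  exists [seq (p.1.1 * p.2, p.1.2) | p <- t].
    by move=> _ /mapP[p /mt mp ->].
  rewrite big_map big_seq [RHS]big_seq; apply: eq_bigr => p /mt /mZ Zp.
  by rewrite -mulrA Zp mulrA.
exists [seq (p.1, p.2, 1) | p <- t]; first by move=> _ /mapP[p /mt mp ->].
by rewrite big_map; apply: eq_bigr => p _; rewrite mulr1.
Qed.

(* the number N is the square root of the rank of A over its center;
   quot_alg m is A / (m) *)
Definition azumaya_locus (N : nat) : set (set A) :=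
  [set m | center_max_ideal m /\
     exists f : quot_alg m -> 'M[K]_N,
       [/\ linear f, monoid_morphism f & bijective f]].

End Center.

(* multinomials only declares an algType structure on {malg K[M]} for M
   commutative, whence the separate name for the free algebra on T *)
Section FreeAlgebra.
Variables (K : comNzRingType) (T : choiceType).

Definition free_alg : Type := {malg K[{fmonom T}]}.
HB.instance Definition _ := GRing.Lalgebra.on free_alg.

Definition free_gen (t : T) : free_alg := << fmu t >>.

Let malg_scalerAr (c : K) (g h : {malg K[{fmonom T}]}) :
  c *: (g * h) = g * (c *: h).
Proof.
have cC : g * c%:MP = c%:MP * g.
  rewrite mul_malgC malgM_def fgmulgU malgZ_def.
  by apply: eq_bigr => k _; rewrite mulm1 mulrC.
by rewrite -(mul_malgC c h) (mulrA g) cC -mulrA mul_malgC.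
Qed.

Lemma free_scalerAr (c : K) (g h : free_alg) : c *: (g * h) = g * (c *: h).
Proof. exact: malg_scalerAr. Qed.

HB.instance Definition _ := GRing.Lalgebra_isAlgebra.Build K free_alg
  free_scalerAr.

End FreeAlgebra.

Section QuantumWeyl.
Variables (K : comNzRingType) (n : nat) (q : K).

Local Notation Fn := (free_alg K ('I_n + 'I_n)%type).

Definition free_x (i : 'I_n) : Fn := free_gen K (inl i).
Definition free_d (i : 'I_n) : Fn := free_gen K (inr i).

Inductive qweyl_rel : Fn -> Prop :=
| QWeylDX i j : qweyl_rel
    (free_d i * free_x j - q ^+ (i == j) *: (free_x j * free_d i) - (i == j)%:R)
| QWeylXX i j : qweyl_rel (free_x i * free_x j - free_x j * free_x i)
| QWeylDD i j : qweyl_rel (free_d i * free_d j - free_d j * free_d i).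

Definition qweyl : Type := quot_alg qweyl_rel.

HB.instance Definition _ := GRing.PzRing.on qweyl.
HB.instance Definition _ := GRing.Lmodule.on qweyl.

(* x_i multiplies formal power series, given by their coefficients, by X_i,
   and d_i is the i-th q-derivative; this shows that 1 != 0 in qweyl *)
Let V := ('I_n -> nat) -> K.
Let inc (i : 'I_n) (e : 'I_n -> nat) := fun j => (e j + (j == i))%N.
Let dec (i : 'I_n) (e : 'I_n -> nat) := fun j => (e j - (j == i))%N.
Let qint (m : nat) : K := \sum_(k < m) q ^+ k.

Let agen (g : ('I_n + 'I_n)%type) (v : V) : V := fun e =>
  match g with
  | inl i => if e i == 0%N then 0 else v (dec i e)
  | inr i => qint (e i).+1 * v (inc i e)
  end.
Let aword (w : seq ('I_n + 'I_n)%type) (v : V) : V := foldr agen v w.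
Let act (g : Fn) (v : V) : V :=
  fun e => \sum_(k <- msupp g) g@_k * aword k v e.

Let aword_sum (I : Type) (r : seq I) (c : I -> K) (f : I -> V) w e :
  aword w (fun e => \sum_(k <- r) c k * f k e) e =
  \sum_(k <- r) c k * aword w (f k) e.
Proof.
elim: w e => [//|g w IH] e /=; case: g => i /=; last first.
  by rewrite IH mulr_sumr; apply: eq_bigr => k _; rewrite mulrCA.
by case: ifP => // _; rewrite big1 // => k _; rewrite mulr0.
Qed.

Let actEw (d : {fset {fmonom ('I_n + 'I_n)%type}}) g v e : fsubset (msupp g) d ->
  act g v e = \sum_(k <- d) g@_k * aword k v e.
Proof.
move=> le_d; apply: big_fset_incl => // k _ /mcoeff_outdom ->.
by rewrite mul0r.
Qed.

Let actD g h v e : act (g + h) v e = act g v e + act h v e.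
Proof.
rewrite (actEw _ _ (msuppD_le g h)) (actEw _ _ (fsubsetUl (msupp g) (msupp h))).
rewrite (actEw _ _ (fsubsetUr (msupp g) (msupp h))) -big_split.
by apply: eq_bigr => k _; rewrite mcoeffD mulrDl.
Qed.

Let act0 v e : act 0 v e = 0.
Proof. by rewrite /act big1 // => k _; rewrite mcoeff0 mul0r. Qed.

Let actU c k v e : act << c *g k >> v e = c * aword k v e.
Proof. by rewrite (actEw _ _ msuppU_le) big_seq_fset1 mcoeffUU. Qed.

Let act_sum (I : Type) (r : seq I) (f : I -> Fn) v e :
  act (\sum_(k <- r) f k) v e = \sum_(k <- r) act (f k) v e.
Proof. by elim/big_rec2: _ => [|k _ y _ <-]; rewrite ?act0 ?actD. Qed.

Let actM g h v e : act (g * h) v e = act g (act h v) e.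
Proof.
rewrite malgM_def fgmull act_sum; apply: eq_bigr => k _.
rewrite act_sum aword_sum mulr_sumr; apply: eq_bigr => k' _.
by rewrite actU fmM /aword foldr_cat mulrA.
Qed.

Let actZ c g v e : act (c *: g) v e = c * act g v e.
Proof.
rewrite (actEw _ _ (msuppZ_le c g)) mulr_sumr.
by apply: eq_bigr => k _; rewrite mcoeffZ mulrA.
Qed.

Let actB g h v e : act (g - h) v e = act g v e - act h v e.
Proof. by rewrite actD -scaleN1r actZ mulN1r. Qed.

Let act_x i v : act (free_x i) v = agen (inl i) v.
Proof. by apply/funext => e; rewrite actU mul1r fmU. Qed.

Let act_d i v : act (free_d i) v = agen (inr i) v.
Proof. by apply/funext => e; rewrite actU mul1r fmU. Qed.

Let act1 v e : act 1 v e = v e.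
Proof. by rewrite -[1]/(<< mone >> : Fn) actU mul1r fm1. Qed.

Let qintS m : qint m.+1 = 1 + q * qint m.
Proof.
by rewrite /qint big_ord_recl mulr_sumr; congr (_ + _); apply: eq_bigr => k _;
  rewrite exprS.
Qed.

Let act_nat (b : bool) v e : act b%:R v e = b%:R * v e.
Proof. by case: b; rewrite ?act1 ?act0 ?mul1r ?mul0r. Qed.

Let agenDX i j v e : agen (inr i) (agen (inl j) v) e
  - q ^+ (i == j) * agen (inl j) (agen (inr i) v) e - (i == j)%:R * v e = 0.
Proof.
rewrite /agen; have [<-|ne_ij] := eqVneq i j; last first.
  have ne_ji : (j == i) = false by rewrite eq_sym (negPf ne_ij).
  have -> : inc i e j = e j by rewrite /inc ne_ji addn0.
  have -> : dec j e i = e i by rewrite /dec (negPf ne_ij) subn0.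
  case: ifP => e_j; first by rewrite !mulr0 mul0r !subr0.
  rewrite mul0r subr0 mul1r.
  rewrite (_ : dec j (inc i e) = inc i (dec j e)) ?subrr //.
  apply/funext => k; rewrite /inc /dec; have [->|//] := eqVneq k j.
    by rewrite ne_ji !addn0.
  by rewrite !subn0.
have -> : (inc i e i == 0%N) = false by rewrite /inc eqxx addn1.
rewrite mul1r expr1.
have -> : dec i (inc i e) = e by apply/funext => k; rewrite /inc /dec addnK.
case: ifP => [/eqP ->|e_i].
  by rewrite qintS /qint big_ord0 !mulr0 addr0 subr0 mul1r subrr.
have -> : inc i (dec i e) = e.
  apply/funext => k; rewrite /inc /dec subnK //.
  by have [->|//] := eqVneq k i; rewrite lt0n e_i.
have -> : (dec i e i).+1 = e i by rewrite /dec eqxx subn1 prednK ?lt0n ?e_i.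
by rewrite qintS mulrDl mul1r mulrA addrK subrr.
Qed.

Let agenXX i j v e :
  agen (inl i) (agen (inl j) v) e = agen (inl j) (agen (inl i) v) e.
Proof.
rewrite /agen; have [->//|ne_ij] := eqVneq i j.
have ne_ji : (j == i) = false by rewrite eq_sym (negPf ne_ij).
have -> : dec i e j = e j by rewrite /dec ne_ji subn0.
have -> : dec j e i = e i by rewrite /dec (negPf ne_ij) subn0.
rewrite (_ : dec j (dec i e) = dec i (dec j e)); first by do 2!case: ifP.
by apply/funext => k; rewrite /dec subnAC.
Qed.

Let agenDD i j v e :
  agen (inr i) (agen (inr j) v) e = agen (inr j) (agen (inr i) v) e.
Proof.
rewrite /agen; have [->//|ne_ij] := eqVneq i j.
have ne_ji : (j == i) = false by rewrite eq_sym (negPf ne_ij).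
have -> : inc i e j = e j by rewrite /inc ne_ji addn0.
have -> : inc j e i = e i by rewrite /inc (negPf ne_ij) addn0.
rewrite mulrCA.
by congr (_ * (_ * v _)); apply/funext => k; rewrite /inc addnAC.
Qed.

Let actMB g1 g2 g3 g4 v e : act (g1 * g2 - g3 * g4) v e =
  act g1 (act g2 v) e - act g3 (act g4 v) e.
Proof.
exact: etrans (actB _ _ _ _)
  (congr2 (fun s t => s - t) (actM _ _ _ _) (actM _ _ _ _)).
Qed.

Let actMZB g1 g2 g3 g4 c h v e : act (g1 * g2 - c *: (g3 * g4) - h) v e =
  act g1 (act g2 v) e - c * act g3 (act g4 v) e - act h v e.
Proof.
apply: etrans (actB _ _ _ _) (congr1 (fun s => s - act h v e) _).
apply: etrans (actB _ _ _ _) (congr2 (fun s t => s - t) (actM _ _ _ _) _).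
exact: etrans (actZ _ _ _ _) (congr1 ( *%R c) (actM _ _ _ _)).
Qed.

Let act_rel g v : qweyl_rel g -> act g v = fun=> 0.
Proof.
move=> Rg; apply/funext => e; case: Rg => i j.
- by rewrite actMZB act_nat 2!act_d 2!act_x agenDX.
- by rewrite actMB 4!act_x agenXX subrr.
- by rewrite actMB 4!act_d agenDD subrr.
Qed.

Let aword0 w e : aword w (fun=> 0) e = 0.
Proof. by elim: w e => //= -[i|i] w IH e /=; rewrite IH ?mulr0 ?if_same. Qed.

Let act_zero g e : act g (fun=> 0) e = 0.
Proof. by rewrite /act big1 // => k _; rewrite aword0 mulr0. Qed.

Lemma qweyl_nontrivial : 1 != 0 :> qweyl.
Proof.
apply/eqP; rewrite -quot_pi1 -quot_pi0 => /quot_pi_eq; rewrite subr0 => -[t St E].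
suff: act 1 (fun=> 1) (fun=> 0%N) = 0.
  by rewrite act1 => /eqP; rewrite oner_eq0.
rewrite E act_sum big_seq big1 // => p /St Sp.
by rewrite 2!actM (act_rel _ Sp) act_zero.
Qed.

HB.instance Definition _ :=
  GRing.PzSemiRing_isNonZero.Build qweyl qweyl_nontrivial.
HB.instance Definition _ := GRing.Lmodule_isLalgebra.Build K qweyl
  (@quot_scalerAl K Fn qweyl_rel).
HB.instance Definition _ := GRing.Lalgebra_isAlgebra.Build K qweyl
  (@quot_scalerAr K Fn qweyl_rel).

Definition qweyl_x (i : 'I_n) : qweyl := quot_pi qweyl_rel (free_x i).
Definition qweyl_d (i : 'I_n) : qweyl := quot_pi qweyl_rel (free_d i).

Lemma qweyl_dx i j :
  qweyl_d i * qweyl_x j - q ^+ (i == j) *: (qweyl_x j * qweyl_d i) = (i == j)%:R.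
Proof.
have -> : (i == j)%:R = quot_pi qweyl_rel (i == j)%:R.
  by case: (i == j); rewrite ?quot_pi0 ?quot_pi1.
rewrite /qweyl_d /qweyl_x -!quot_piM -quot_piZ -quot_piB.
by apply/quot_pi_eq/gen_ideal_incl; apply: QWeylDX.
Qed.

Lemma qweyl_xx i j : qweyl_x i * qweyl_x j = qweyl_x j * qweyl_x i.
Proof.
rewrite /qweyl_x -!quot_piM.
by apply/quot_pi_eq/gen_ideal_incl; apply: QWeylXX.
Qed.

Lemma qweyl_dd i j : qweyl_d i * qweyl_d j = qweyl_d j * qweyl_d i.
Proof.
rewrite /qweyl_d -!quot_piM.
by apply/quot_pi_eq/gen_ideal_incl; apply: QWeylDD.
Qed.

End QuantumWeyl.

(* Main.v *)
Require Import Defs.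
From HB Require Import structures.
From mathcomp Require Import all_boot all_algebra.
From mathcomp Require Import generic_quotient finmap monalg ring.
From mathcomp Require Import boolp classical_sets functions reals complex.

Set Implicit Arguments.
Unset Strict Implicit.
Unset Printing Implicit Defensive.

Import GRing.Theory.

Local Open Scope ring_scope.
Local Open Scope classical_set_scope.

(** The normal element u_i = 1 + (q - 1) x_i d_i satisfies u_i x_i = q x_i u_i,
    d_i u_i = q u_i d_i and (1 - q)^l x_i^l d_i^l = 1 - u_i^l, so the condition
    a_i b_i = (1 - q)^-l says that u_i is nilpotent modulo m.

    If A/(m) is a matrix algebra and u_i is nilpotent in it, then normality makes
    ker u_i invariant under all matrices, whence u_i = 0.  Then x_i and d_i
    commute, x_i is a scalar c, and the twist x_j -> q x_j, d_j -> q^-1 d_j, which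
    preserves m, gives q c = c; so c = 0, contradicting (1 - q) x_i d_i = 1.

    Otherwise A acts on the space with basis (Z/l)^n through weighted shifts, u_i
    being diagonal with eigenvalues mu_i q^k, where mu_i^l = 1 - (1 - q)^l a_i b_i
    is not 0.  The u_i separate the basis vectors and the shifts connect them, so
    the action is onto the matrix algebra; it is faithful on A/(m), which is
    spanned by l^(2n) monomials.  That m is maximal follows from the description
    of the center, read off from the linear independence of the monomials
    x^alpha d^beta, i.e., from the left regular representation. *)

(** * Modules over the quantum Weyl algebra *)

Section FreeAction.
Variables (K : comNzRingType) (T : choiceType) (V : lmodType K).
Variable op : T -> {linear V -> V}.

Local Notation F := (free_alg K T).

Definition word_act (w : seq T) (v : V) : V := foldr (fun t => op t) v w.

Definition free_act (g : F) (v : V) : V :=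
  \sum_(k <- msupp g) g@_k *: word_act k v.

Lemma word_act_linear w : linear (word_act w).
Proof. by elim: w => [|t w IH] c u v //=; rewrite IH linearP. Qed.

HB.instance Definition _ w :=
  GRing.isLinear.Build K V V *:%R (word_act w) (word_act_linear w).

Lemma free_actEw (d : {fset {fmonom T}}) g v : fsubset (msupp g) d ->
  free_act g v = \sum_(k <- d) g@_k *: word_act k v.
Proof.
move=> le_d; apply: big_fset_incl => // k _ /mcoeff_outdom ->.
by rewrite scale0r.
Qed.

Lemma free_act_linear g : linear (free_act g).
Proof.
move=> c u v; rewrite scaler_sumr -big_split; apply: eq_bigr => k _ /=.
by rewrite linearP scalerDr !scalerA mulrC.
Qed.

HB.instance Definition _ g :=
  GRing.isLinear.Build K V V *:%R (free_act g) (free_act_linear g).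

Lemma free_actD g h v : free_act (g + h) v = free_act g v + free_act h v.
Proof.
rewrite (free_actEw _ (msuppD_le g h)) (free_actEw _ (fsubsetUl (msupp g) (msupp h))).
rewrite (free_actEw _ (fsubsetUr (msupp g) (msupp h))) -big_split.
by apply: eq_bigr => k _; rewrite mcoeffD scalerDl.
Qed.

Lemma free_actZ (c : K) g v : free_act (c *: g) v = c *: free_act g v.
Proof.
rewrite (free_actEw _ (msuppZ_le c g)) scaler_sumr.
by apply: eq_bigr => k _; rewrite mcoeffZ scalerA.
Qed.

Lemma free_act0 v : free_act 0 v = 0.
Proof. by rewrite -(scale0r (0 : F)) free_actZ scale0r. Qed.

Lemma free_actB g h v : free_act (g - h) v = free_act g v - free_act h v.
Proof. by rewrite free_actD -[- h]scaleN1r free_actZ scaleN1r. Qed.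

Lemma free_actU (c : K) k v : free_act << c *g k >> v = c *: word_act k v.
Proof. by rewrite (free_actEw _ msuppU_le) big_seq_fset1 mcoeffUU. Qed.

Lemma free_act_sum (I : Type) (r : seq I) (f : I -> F) v :
  free_act (\sum_(k <- r) f k) v = \sum_(k <- r) free_act (f k) v.
Proof. by elim/big_rec2: _ => [|k _ y _ <-]; rewrite ?free_act0 ?free_actD. Qed.

Lemma free_actM g h v : free_act (g * h) v = free_act g (free_act h v).
Proof.
rewrite malgM_def fgmull free_act_sum; apply: eq_bigr => k _.
rewrite free_act_sum.
rewrite linear_sum scaler_sumr; apply: eq_bigr => k' _.
by rewrite free_actU fmM /word_act foldr_cat linearZ scalerA.
Qed.

Lemma free_act_gen t v : free_act (free_gen K t) v = op t v.
Proof. by rewrite free_actU scale1r fmU. Qed.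

Lemma free_act1 v : free_act 1 v = v.
Proof. by rewrite -[1]/(<< mone >> : F) free_actU scale1r fm1. Qed.

Lemma free_act_comm g1 g2 g3 g4 v : free_act (g1 * g2 - g3 * g4) v =
  free_act g1 (free_act g2 v) - free_act g3 (free_act g4 v).
Proof. by apply: etrans (free_actB _ _ _) _; congr (_ - _); apply: free_actM. Qed.

Lemma free_act_qcomm g1 g2 g3 g4 c h v :
  free_act (g1 * g2 - c *: (g3 * g4) - h) v =
  free_act g1 (free_act g2 v) - c *: free_act g3 (free_act g4 v) - free_act h v.
Proof.
rewrite 2!free_actB free_actZ.
by congr (_ - _ *: _ - _); apply: free_actM.
Qed.

Lemma free_act_nat (b : bool) v : free_act b%:R v = v *+ b.
Proof. by case: b; rewrite ?free_act1 ?free_act0. Qed.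

End FreeAction.

Section QweylAction.
Variables (K : comNzRingType) (n : nat) (q : K) (V : lmodType K).
Variables opx opd : 'I_n -> {linear V -> V}.
Hypothesis opDX : forall i j v, opd i (opx j v) =
  q ^+ (i == j) *: opx j (opd i v) + v *+ (i == j).
Hypothesis opXX : forall i j v, opx i (opx j v) = opx j (opx i v).
Hypothesis opDD : forall i j v, opd i (opd j v) = opd j (opd i v).

Local Notation A := (qweyl n q).
Local Notation pi := (quot_pi (qweyl_rel (n := n) q)).

Let op (t : 'I_n + 'I_n) : {linear V -> V} :=
  match t with inl i => opx i | inr i => opd i end.

Let fact := free_act op.

Lemma free_act_rel g v : qweyl_rel q g -> fact g v = 0.
Proof.
rewrite /fact; case=> i j.
- apply: etrans (free_act_qcomm _ _ _ _ _ _ _ _) _.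
  by rewrite free_act_nat 4!free_act_gen /= opDX addrAC addrK subrr.
- apply: etrans (free_act_comm _ _ _ _ _ _) _.
  by rewrite 4!free_act_gen /= opXX subrr.
- apply: etrans (free_act_comm _ _ _ _ _ _) _.
  by rewrite 4!free_act_gen /= opDD subrr.
Qed.

(** [repr] picks an arbitrary preimage in the free algebra; [qweyl_act_pi] shows that the choice
    does not matter. *)
Definition qweyl_act (a : A) (v : V) : V := fact (repr a) v.

Lemma qweyl_act_pi g v : qweyl_act (pi g) v = fact g v.
Proof.
(* The chosen preimage differs from [g] by a sum of two-sided multiples of relations, and relations
   act as 0. *)
have /quot_pi_eq [t tR /eqP] := quot_piK (pi g).
rewrite subr_eq => /eqP E; rewrite /qweyl_act E /fact free_actD free_act_sum.
rewrite big_seq big1 ?add0r // => p /tR pR.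
rewrite !free_actM -/fact [fact p.1.2 _](free_act_rel _ pR).
exact: linear0.
Qed.

Lemma qweyl_act_linear a : linear (qweyl_act a).
Proof. exact: free_act_linear. Qed.

HB.instance Definition _ a :=
  GRing.isLinear.Build K V V *:%R (qweyl_act a) (qweyl_act_linear a).

Lemma qweyl_actDl a b v : qweyl_act (a + b) v = qweyl_act a v + qweyl_act b v.
Proof.
elim/quot_ind: a => a; elim/quot_ind: b => b.
by rewrite -[_ + _](quot_piD) !qweyl_act_pi /fact free_actD.
Qed.

Lemma qweyl_actZl (c : K) a v : qweyl_act (c *: a) v = c *: qweyl_act a v.
Proof.
elim/quot_ind: a => a.
by rewrite -[c *: _](quot_piZ) !qweyl_act_pi /fact free_actZ.
Qed.

Lemma qweyl_actM a b v : qweyl_act (a * b) v = qweyl_act a (qweyl_act b v).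
Proof.
elim/quot_ind: a => a; elim/quot_ind: b => b.
by rewrite -[_ * _](quot_piM) !qweyl_act_pi /fact free_actM.
Qed.

Lemma qweyl_act1 v : qweyl_act 1 v = v.
Proof. by rewrite -[1]quot_pi1 qweyl_act_pi /fact free_act1. Qed.

Lemma qweyl_act_x i v : qweyl_act (qweyl_x q i) v = opx i v.
Proof. by rewrite qweyl_act_pi /fact free_act_gen. Qed.

Lemma qweyl_act_d i v : qweyl_act (qweyl_d q i) v = opd i v.
Proof. by rewrite qweyl_act_pi /fact free_act_gen. Qed.

Lemma qweyl_act_gen_ideal (S : set A) a v :
  (forall s u, S s -> qweyl_act s u = 0) -> gen_ideal S a -> qweyl_act a v = 0.
Proof.
move=> S0 [t tS ->]; rewrite big_seq; elim/big_ind: _ => [|x y x0 y0|p /tS Sp].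
- by rewrite -(scale0r (0 : A)) qweyl_actZl scale0r.
- by rewrite qweyl_actDl x0 y0 addr0.
- by rewrite !qweyl_actM (S0 _ _ Sp) linear0.
Qed.

(** To see that the two-sided ideal (m) acts as 0 it is enough to test the generators of m. Both
    directions rely on this. *)
Lemma qweyl_act_center_gen_ideal (G : set A) a v :
  (forall g u, G g -> qweyl_act g u = 0) ->
  gen_ideal (center_gen_ideal G) a -> qweyl_act a v = 0.
Proof.
move=> G0; apply: qweyl_act_gen_ideal => s u [t tG ->].
rewrite big_seq; elim/big_ind: _ => [|x y x0 y0|p /tG[_ Gp]].
- by rewrite -(scale0r (0 : A)) qweyl_actZl scale0r.
- by rewrite qweyl_actDl x0 y0 addr0.
- by rewrite qweyl_actM (G0 _ _ Gp) linear0.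
Qed.

End QweylAction.

Section QweylInd.
Variables (K : comNzRingType) (n : nat) (q : K).
Local Notation A := (qweyl n q).

(** A word grows by prepending letters, so closure under left multiplication by generators
    suffices. *)
Lemma qweyl_ind (P : A -> Prop) :
  P 1 -> (forall a b, P a -> P b -> P (a + b)) ->
  (forall c a, P a -> P (c *: a)) ->
  (forall i a, P a -> P (qweyl_x q i * a)) ->
  (forall i a, P a -> P (qweyl_d q i * a)) ->
  forall a, P a.
Proof.
move=> P1 PD PZ Px Pd; elim/quot_ind=> g; rewrite (monalgE g).
have P0 : P 0 by rewrite -(scale0r (1 : A)); apply: PZ.
elim/big_rec: _ => [|k h _ Ph]; first by rewrite quot_pi0.
rewrite quot_piD; apply: (PD) => //.
have -> : << g@_k *g k >> = g@_k *: (<< k >> : free_alg K ('I_n + 'I_n)%type).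
  by apply/malgP => k'; rewrite mcoeffZ !mcoeffU mulr_natr.
rewrite quot_piZ; apply: (PZ).
case: k => w; elim: w => [|t w IH].
  have -> : << FMonom [::] >> = 1 :> free_alg K ('I_n + 'I_n)%type.
    by rewrite -fmoneE.
  by rewrite quot_pi1.
have -> : << FMonom (t :: w) >> =
    free_gen K t * << FMonom w >> :> free_alg K ('I_n + 'I_n)%type.
  rewrite malgM_def fgmulUU mulr1; congr << _ *g _ >>.
  by apply/eqP; rewrite fmP fmM fmU.
by rewrite quot_piM; case: t => i; [apply: (Px) | apply: (Pd)].
Qed.

End QweylInd.

(** * One pair of generators *)

Section QPair.
Variables (K : fieldType) (q : K).

Definition qint (m : nat) : K := \sum_(k < m) q ^+ k.

Lemma qintE m : (q - 1) * qint m = q ^+ m - 1.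
Proof. by rewrite subrX1. Qed.

Lemma qintS m : qint m.+1 = q * qint m + 1.
Proof.
rewrite /qint big_ord_recl addrC mulr_sumr; congr (_ + _).
by apply: eq_bigr => k _; rewrite exprS.
Qed.

Lemma qintSr m : qint m.+1 = qint m + q ^+ m.
Proof. by rewrite /qint big_ord_recr. Qed.

Lemma prim_root_neq0 l : l.-primitive_root q -> q != 0.
Proof.
move=> hq; apply/eqP => q0; have /eqP := prim_expr_order hq.
by rewrite q0 expr0n (gtn_eqF (prim_order_gt0 hq)) eq_sym oner_eq0.
Qed.

(** Each factor is -q^-j times X - q^j, so the product is a constant multiple of X^l - 1. *)
Lemma prod_1_sub_prim_expr l (hq : l.-primitive_root q) :
  \prod_(j < l) (1 - q ^- j *: 'X) = 1 - 'X^l :> {poly K}.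
Proof.
have l0 := prim_order_gt0 hq.
have q0 := prim_root_neq0 hq.
pose c : K := \prod_(j < l) - q ^- j.
have E : \prod_(j < l) (1 - q ^- j *: 'X) = c *: ('X^l - 1) :> {poly K}.
  rewrite -(factor_Xn_sub_1 hq) big_mkord -scaler_prod; apply: eq_bigr => j _.
  rewrite scalerBr scaleNr -mul_polyC -[- q ^- j *: _]mul_polyC polyCN mulNr.
  by rewrite opprK -polyCM mulVf ?expf_neq0 // addrC.
(* Evaluation at 0 identifies the constant as -1. *)
have := congr1 (fun p => p.[0]) E.
rewrite hornerZ !hornerE /= expr0n (gtn_eqF l0) sub0r mulrN1 horner_prod big1.
  by move=> c1; rewrite E -[c]opprK -c1 scaleN1r opprB.
by move=> j _; rewrite !hornerE ?mulr0 ?subr0.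
Qed.

Variables (A : algType K) (x d : A).
Hypothesis dx : d * x = q *: (x * d) + 1.

(** The q-Leibniz rule for a power. At m = 0 the truncated exponent [m.-1] is harmless, its
    coefficient being [qint 0 = 0]. *)
Lemma qpair_dXn m : d * x ^+ m = q ^+ m *: (x ^+ m * d) + qint m *: x ^+ m.-1.
Proof.
elim: m => [|m IH]; first by rewrite mulr1 mul1r /qint big_ord0 scale0r scale1r addr0.
have -> : d * x ^+ m.+1 = (d * x ^+ m) * x by rewrite exprSr mulrA.
rewrite IH mulrDl -!scalerAl -(mulrA _ d) dx mulrDr mulr1 -scalerAr mulrA -exprSr.
rewrite scalerDr scalerA -exprSr -addrA; congr (_ + _).
case: m {IH} => [|m]; first by rewrite /qint big_ord0 big_ord1 scale0r addr0.
by rewrite -exprSr -scalerDl addrC -qintSr.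
Qed.

Lemma qpair_dnX m : d ^+ m * x = q ^+ m *: (x * d ^+ m) + qint m *: d ^+ m.-1.
Proof.
elim: m => [|m IH]; first by rewrite mulr1 mul1r /qint big_ord0 scale0r scale1r addr0.
have -> : d ^+ m.+1 * x = d * (d ^+ m * x) by rewrite exprS mulrA.
rewrite IH mulrDr -!scalerAr (mulrA d) dx mulrDl mul1r -scalerAl -mulrA -exprS.
rewrite scalerDr scalerA -exprSr -addrA; congr (_ + _).
case: m {IH} => [|m]; first by rewrite /qint big_ord0 big_ord1 scale0r addr0.
by rewrite -exprS -scalerDl addrC -qintSr.
Qed.

(** The normal element u; by the relation it equals the commutator d x - x d. *)
Definition qeuler : A := 1 + (q - 1) *: (x * d).

Lemma qeuler_x : qeuler * x = q *: (x * qeuler).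
Proof.
have E : x * d * x = q *: (x * (x * d)) + x by rewrite -mulrA dx mulrDr mulr1 -scalerAr.
have F : x + (q - 1) *: x = q *: x by rewrite scalerBl scale1r addrC subrK.
rewrite /qeuler mulrDl mul1r mulrDr mulr1 -scalerAl -scalerAr E.
by rewrite !scalerDr !scalerA addrCA F addrC mulrC.
Qed.

Lemma qeuler_d : d * qeuler = q *: (qeuler * d).
Proof.
have E : d * (x * d) = q *: (x * d * d) + d by rewrite mulrA dx mulrDl mul1r -scalerAl.
have F : d + (q - 1) *: d = q *: d by rewrite scalerBl scale1r addrC subrK.
rewrite /qeuler mulrDl mul1r mulrDr mulr1 -scalerAl -scalerAr E.
by rewrite !scalerDr !scalerA addrCA F addrC mulrC.
Qed.

Lemma qeuler_comm g : g * x = x * g -> g * d = d * g -> g * qeuler = qeuler * g.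
Proof.
move=> gx gd; rewrite /qeuler mulrDr mulrDl mulr1 mul1r -scalerAr -scalerAl.
by rewrite mulrA gx -!mulrA gd.
Qed.

Lemma qeuler_Xn m : q != 0 -> x ^+ m * qeuler = q ^- m *: (qeuler * x ^+ m).
Proof.
move=> q0; elim: m => [|m IH]; first by rewrite expr0 invr1 scale1r mulr1 mul1r.
rewrite exprSr -[LHS]mulrA.
have -> : x * qeuler = q^-1 *: (qeuler * x).
  by rewrite qeuler_x scalerA mulVf ?scale1r.
by rewrite -scalerAr !mulrA IH -scalerAl scalerA exprS invfM.
Qed.

(** Since (1 - q) x d = 1 - u, the innermost pair in x^(m+1) d^(m+1) becomes 1 - u, and moving x^m
    past it turns u into q^-m u. At m = l the product collapses to 1 - u^l. *)
Lemma qeuler_prod m : q != 0 ->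
  (1 - q) ^+ m *: (x ^+ m * d ^+ m) =
  horner_alg qeuler (\prod_(j < m) (1 - q ^- j *: 'X)).
Proof.
move=> q0; elim: m => [|m IH].
  by rewrite big_ord0 rmorph1 mulr1 scale1r.
have E1 : (1 - q) *: (x ^+ m.+1 * d ^+ m.+1) = x ^+ m * (1 - qeuler) * d ^+ m.
  have -> : 1 - qeuler = (1 - q) *: (x * d).
    by rewrite /qeuler opprD addrA subrr add0r -scaleNr opprB.
  by rewrite -scalerAr -scalerAl exprSr exprS !mulrA.
have E2 : x ^+ m * (1 - qeuler) = (1 - q ^- m *: qeuler) * x ^+ m.
  by rewrite mulrBr mulr1 qeuler_Xn // mulrBl mul1r -scalerAl.
rewrite big_ord_recr /= mulrC rmorphM /= -IH rmorphB /= rmorph1 linearZ /=.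
by rewrite horner_algX mulr_algl exprSr -scalerA E1 E2 -mulrA scalerAr.
Qed.

Lemma qeuler_expl l : l.-primitive_root q ->
  (1 - q) ^+ l *: (x ^+ l * d ^+ l) = 1 - qeuler ^+ l.
Proof.
move=> hq; rewrite qeuler_prod ?(prim_root_neq0 hq) //.
by rewrite prod_1_sub_prim_expr // rmorphB rmorph1 rmorphXn /= horner_algX.
Qed.

End QPair.

(** * Monomials *)

Section CommProd.
Variables (B : pzRingType) (n : nat) (y : 'I_n -> B).
Hypothesis yC : forall i j, y i * y j = y j * y i.

Lemma prod_exprD (e f : 'I_n -> nat) :
  \prod_i y i ^+ (e i + f i) = (\prod_i y i ^+ e i) * \prod_i y i ^+ f i.
Proof.
rewrite -prodrM_comm; first by apply: eq_bigr => i _; rewrite exprD.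
by move=> i j _ _; apply/commrX/commr_sym/commrX; apply: yC.
Qed.

Lemma prod_expr1 i m : \prod_j y j ^+ (if j == i then m else 0%N) = y i ^+ m.
Proof.
rewrite (eq_bigr (fun j => if j == i then y j ^+ m else 1)).
  by rewrite -big_mkcond big_pred1_eq.
by move=> j _; case: eqP.
Qed.

Lemma prod_exprS i e : \prod_j y j ^+ (e j + (j == i)) = y i * \prod_j y j ^+ e j.
Proof.
rewrite -[y i in RHS]expr1 -(prod_expr1 i 1) -prod_exprD.
by apply: eq_bigr => j _; rewrite addnC; case: eqP.
Qed.

Lemma prod_exprD1 i e : \prod_j y j ^+ e j =
  y i ^+ e i * \prod_j y j ^+ (if j == i then 0 else e j)%N.
Proof.
rewrite -prod_expr1 -prod_exprD; apply: eq_bigr => j _.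
by case: eqP => [->|]; rewrite ?addn0.
Qed.

End CommProd.

Section Monomials.
Variables (K : fieldType) (n : nat) (q : K).

Local Notation A := (qweyl n q).
Local Notation X := (@qweyl_x K n q).
Local Notation D := (@qweyl_d K n q).
Local Notation mi := {ffun 'I_n + 'I_n -> nat}.

Lemma qweyl_dx_eq i : D i * X i = q *: (X i * D i) + 1.
Proof.
have := qweyl_dx q i i; rewrite eqxx => /eqP.
by rewrite subr_eq addrC => /eqP.
Qed.

Lemma qweyl_dx_neq i j : i != j -> D i * X j = X j * D i.
Proof.
move=> /negPf ij; have := qweyl_dx q i j; rewrite ij scale1r => /eqP.
by rewrite subr_eq0 => /eqP.
Qed.

(** [D i] commutes with every factor except the i-th, to which the one-variable rule applies. *)
Lemma qweyl_d_prod_x i (e : 'I_n -> nat) :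
  D i * \prod_j X j ^+ e j = q ^+ e i *: ((\prod_j X j ^+ e j) * D i)
    + qint q (e i) *: \prod_j X j ^+ (e j - (j == i)).
Proof.
rewrite (prod_exprD1 (@qweyl_xx K n q) i e).
rewrite (prod_exprD1 (@qweyl_xx K n q) i (fun j => (e j - (j == i))%N)) eqxx subn1.
have -> : \prod_j X j ^+ (if j == i then 0 else e j - (j == i))%N =
    \prod_j X j ^+ (if j == i then 0 else e j)%N.
  by apply: eq_bigr => j _; case: eqP; rewrite ?subn0.
set R := \prod_j _.
have DR : D i * R = R * D i.
  apply: commr_prod => j _; case: (j =P i) => [->|/eqP ij]; first exact: commr1.
  by apply: commrX; rewrite /GRing.comm qweyl_dx_neq // eq_sym.
rewrite mulrA (qpair_dXn (qweyl_dx_eq i)) mulrDl -!scalerAl -!mulrA DR.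
by [].
Qed.

Lemma qweyl_prod_d_x i (e : 'I_n -> nat) :
  (\prod_j D j ^+ e j) * X i = q ^+ e i *: (X i * \prod_j D j ^+ e j)
    + qint q (e i) *: \prod_j D j ^+ (e j - (j == i)).
Proof.
rewrite (prod_exprD1 (@qweyl_dd K n q) i e).
rewrite (prod_exprD1 (@qweyl_dd K n q) i (fun j => (e j - (j == i))%N)) eqxx subn1.
have -> : \prod_j D j ^+ (if j == i then 0 else e j - (j == i))%N =
    \prod_j D j ^+ (if j == i then 0 else e j)%N.
  by apply: eq_bigr => j _; case: eqP; rewrite ?subn0.
set R := \prod_j _.
have RX : R * X i = X i * R.
  apply/esym/commr_prod => j _; case: (j =P i) => [->|/eqP ij]; first exact: commr1.
  by apply: commrX; rewrite /GRing.comm qweyl_dx_neq.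
rewrite -mulrA RX mulrA (qpair_dnX (qweyl_dx_eq i)) mulrDl -!scalerAl -!mulrA.
by [].
Qed.

(** Normally ordered monomials, all x to the left of all d; [inl] carries the exponents of x and
    [inr] those of d. *)
Definition qmon (g : mi) : A :=
  (\prod_i X i ^+ g (inl i)) * \prod_i D i ^+ g (inr i).

Definition incr_at t (g : mi) : mi := [ffun s => g s + (s == t)]%N.
(* Subtraction truncates at exponent 0; in [d_qmon] and [qmon_x] the term that
   this affects has coefficient qint q 0 = 0. *)
Definition decr_at t (g : mi) : mi := [ffun s => g s - (s == t)]%N.

Lemma qmon0 : qmon [ffun=> 0%N] = 1.
Proof. by rewrite /qmon !big1 ?mulr1 // => i _; rewrite ffunE. Qed.

Lemma x_qmon i g : X i * qmon g = qmon (incr_at (inl i) g).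
Proof.
rewrite /qmon mulrA -(prod_exprS (@qweyl_xx K n q)).
by congr (_ * _); apply: eq_bigr => j _; rewrite ffunE ?addn0.
Qed.

Lemma qmon_d i g : qmon g * D i = qmon (incr_at (inr i) g).
Proof.
have DC : D i * \prod_j D j ^+ g (inr j) = (\prod_j D j ^+ g (inr j)) * D i.
  by apply: commr_prod => j _; apply: commrX; apply: qweyl_dd.
rewrite /qmon -mulrA -DC -(prod_exprS (@qweyl_dd K n q)).
by congr (_ * _); apply: eq_bigr => j _; rewrite ffunE ?addn0.
Qed.

Lemma d_qmon i g : D i * qmon g = q ^+ g (inl i) *: qmon (incr_at (inr i) g)
  + qint q (g (inl i)) *: qmon (decr_at (inl i) g).
Proof.
rewrite /qmon mulrA qweyl_d_prod_x mulrDl -!scalerAl -mulrA.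
rewrite -(prod_exprS (@qweyl_dd K n q)).
congr (_ *: (_ * _) + _ *: (_ * _)); apply: eq_bigr => j _; rewrite ffunE //=;
  by rewrite ?addn0 ?subn0.
Qed.

Lemma qmon_x i g : qmon g * X i = q ^+ g (inr i) *: qmon (incr_at (inl i) g)
  + qint q (g (inr i)) *: qmon (decr_at (inr i) g).
Proof.
rewrite /qmon -mulrA qweyl_prod_d_x mulrDr -!scalerAr mulrA.
have XC : X i * \prod_j X j ^+ g (inl j) = (\prod_j X j ^+ g (inl j)) * X i.
  by apply: commr_prod => j _; apply: commrX; apply: qweyl_xx.
rewrite -XC -(prod_exprS (@qweyl_xx K n q)).
congr (_ *: (_ * _) + _ *: (_ * _)); apply: eq_bigr => j _; rewrite ffunE //=;
  by rewrite ?addn0 ?subn0.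
Qed.

(** The span of the normally ordered monomials contains 1 and is stable under left multiplication by
    the generators. *)
Lemma qmon_span (a : A) :
  exists s : seq (K * mi), a = \sum_(p <- s) p.1 *: qmon p.2.
Proof.
elim/qweyl_ind: a => [|a b [s ->] [t ->]|c a [s ->]|i a [s ->]|i a [s ->]].
- by exists [:: (1, [ffun=> 0%N])]; rewrite big_seq1 scale1r qmon0.
- by exists (s ++ t); rewrite big_cat.
- exists [seq (c * p.1, p.2) | p : K * mi <- s]; rewrite big_map scaler_sumr.
  by apply: eq_bigr => p _; rewrite scalerA.
- exists [seq (p.1, incr_at (inl i) p.2) | p : K * mi <- s]; rewrite big_map mulr_sumr.
  by apply: eq_bigr => p _; rewrite -scalerAr x_qmon.
exists ([seq (p.1 * q ^+ p.2 (inl i), incr_at (inr i) p.2) | p : K * mi <- s] ++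
        [seq (p.1 * qint q (p.2 (inl i)), decr_at (inl i) p.2) | p : K * mi <- s]).
rewrite big_cat /= !big_map mulr_sumr -big_split; apply: eq_bigr => p _ /=.
by rewrite -scalerAr d_qmon scalerDr !scalerA.
Qed.

End Monomials.

(** * The regular representation and the center *)

Section RegularRep.
Variables (K : fieldType) (n : nat) (q : K).

Local Notation A := (qweyl n q).
Local Notation X := (@qweyl_x K n q).
Local Notation D := (@qweyl_d K n q).
Local Notation mi := {ffun 'I_n + 'I_n -> nat}.
Local Notation V := (mi -> K^o).

(* v : V stands for the formal sum of the v g *: qmon q g, and [reg_x], [reg_d]
   for left multiplication by the generators. *)
Definition shift_at t (v : V) : V := fun g =>
  if g t == 0%N then 0 else v (decr_at t g).

Definition reg_x i : V -> V := shift_at (inl i).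

Definition reg_d i (v : V) : V := fun g =>
  q ^+ g (inl i) * shift_at (inr i) v g +
  qint q (g (inl i)).+1 * v (incr_at (inl i) g).

Lemma incr_atK t : cancel (@incr_at n t) (decr_at t).
Proof. by move=> g; apply/ffunP => s; rewrite !ffunE addnK. Qed.

Lemma decr_atK t (g : mi) : g t != 0%N -> incr_at t (decr_at t g) = g.
Proof.
move=> gt; apply/ffunP => s; rewrite !ffunE subnK //.
by case: (s =P t) => // ->; rewrite lt0n.
Qed.

Lemma incr_atC s t (g : mi) : incr_at s (incr_at t g) = incr_at t (incr_at s g).
Proof. by apply/ffunP => r; rewrite !ffunE addnAC. Qed.

Lemma decr_atC s t (g : mi) : decr_at s (decr_at t g) = decr_at t (decr_at s g).
Proof. by apply/ffunP => r; rewrite !ffunE subnAC. Qed.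

Lemma incr_decr_atC s t (g : mi) : s != t ->
  incr_at s (decr_at t g) = decr_at t (incr_at s g).
Proof.
move=> st; apply/ffunP => r; rewrite !ffunE.
case: (r =P s) => [->|]; rewrite ?addn0 //.
by rewrite (negPf st) !subn0.
Qed.

Lemma shift_atC s t v : shift_at s (shift_at t v) = shift_at t (shift_at s v).
Proof.
have [->//|st] := eqVneq s t; apply/funext => g.
rewrite /shift_at !ffunE [t == s]eq_sym (negPf st) !subn0 decr_atC.
by do 2!case: ifP.
Qed.

Lemma fct_linE (c : K) (u v : V) g : (c *: u + v) g = c * u g + v g.
Proof. by []. Qed.

Lemma shift_at_linE t (c : K) (u v : V) g :
  shift_at t (c *: u + v) g = c * shift_at t u g + shift_at t v g.
Proof. by rewrite /shift_at; case: ifP; rewrite ?mulr0 ?addr0. Qed.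

Lemma reg_x_linear i : linear (reg_x i).
Proof. by move=> c u v; apply/funext => g; apply: shift_at_linE. Qed.

Lemma reg_d_linear i : linear (reg_d i).
Proof.
have lin_aux (a b c x y z w : K) :
    a * (c * x + y) + b * (c * z + w) = c * (a * x + b * z) + (a * y + b * w).
  by ring.
move=> c u v; apply/funext => g.
by rewrite fct_linE /reg_d shift_at_linE fct_linE; apply: lin_aux.
Qed.

HB.instance Definition _ i :=
  GRing.isLinear.Build K V V *:%R (reg_x i) (reg_x_linear i).
HB.instance Definition _ i :=
  GRing.isLinear.Build K V V *:%R (reg_d i) (reg_d_linear i).

Lemma reg_dx i j v : reg_d i (reg_x j v) =
  q ^+ (i == j) *: reg_x j (reg_d i v) + v *+ (i == j).
Proof.
apply/funext => g; rewrite fct_linE /reg_d /reg_x.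
rewrite [shift_at (inr i) _]shift_atC /shift_at !ffunE /=.
rewrite (_ : (inl i == inl j :> 'I_n + 'I_n) = (i == j)) // subn0.
rewrite (_ : (inl j == inl i :> 'I_n + 'I_n) = (j == i)) //.
have [<-|ij] := eqVneq i j; last first.
  rewrite !subn0 addn0 mulr0n expr0 mul1r [X in _ = _ + X](_ : _ = 0) // addr0.
  case: ifP => _; first by rewrite !mulr0 addr0.
  by rewrite incr_decr_atC.
rewrite mulr1n expr1 addn1 incr_atK /=.
case: ifPn => [/eqP ->|gi]; first by rewrite /= /qint big_ord1 !mulr0 !add0r expr0 mul1r.
rewrite decr_atK // subn1 prednK ?lt0n // qintS mulrDl mul1r mulrDr !mulrA -exprS.
by rewrite prednK ?lt0n // addrA.
Qed.

Lemma reg_xx i j v : reg_x i (reg_x j v) = reg_x j (reg_x i v).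
Proof. exact: shift_atC. Qed.

Lemma reg_dd i j v : reg_d i (reg_d j v) = reg_d j (reg_d i v).
Proof.
have [->//|ij] := eqVneq i j; apply/funext => g; rewrite /reg_d /shift_at !ffunE /=.
have [ij1 ij2] : (inr i == inr j :> 'I_n + 'I_n) = false /\
    (inl i == inl j :> 'I_n + 'I_n) = false by split; apply: negPf.
rewrite ![_ == inr i]eq_sym ![_ == inl i]eq_sym ij1 ij2 !subn0 !addn0.
rewrite decr_atC incr_atC !incr_decr_atC //.
have dd_aux (a b s t u w y z : K) (P Q : bool) :
    a * (if P then 0 else b * (if Q then 0 else u) + t * w)
      + s * (b * (if Q then 0 else y) + t * z) =
    b * (if Q then 0 else a * (if P then 0 else u) + s * y)
      + t * (a * (if P then 0 else w) + s * z).
  by case: P; case: Q; ring.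
exact: dd_aux.
Qed.

Definition delta_at (g : mi) : V := fun h => (h == g)%:R.

(** The vector supported at exponent 0 stands for 1, so letting [a] act on it returns the
    coefficients of [a] in normally ordered monomials. *)
Definition qweyl_coef (a : A) : V :=
  qweyl_act reg_x reg_d a (delta_at [ffun=> 0%N]).

Lemma qweyl_coefD a b g : qweyl_coef (a + b) g = qweyl_coef a g + qweyl_coef b g.
Proof. by rewrite /qweyl_coef (qweyl_actDl reg_dx reg_xx reg_dd); reflexivity. Qed.

Lemma qweyl_coefZ (c : K) a g : qweyl_coef (c *: a) g = c * qweyl_coef a g.
Proof. by rewrite /qweyl_coef (qweyl_actZl reg_dx reg_xx reg_dd). Qed.

Lemma qweyl_coef0 g : qweyl_coef 0 g = 0.
Proof. by rewrite -(scale0r (0 : A)) qweyl_coefZ mul0r. Qed.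

Lemma qweyl_coef_sum (I : Type) (r : seq I) (F : I -> A) g :
  qweyl_coef (\sum_(i <- r) F i) g = \sum_(i <- r) qweyl_coef (F i) g.
Proof.
by elim/big_rec2: _ => [|i u v _ <-]; rewrite ?qweyl_coef0 ?qweyl_coefD.
Qed.

Lemma qweyl_coef_x i a : qweyl_coef (X i * a) = reg_x i (qweyl_coef a).
Proof.
rewrite /qweyl_coef (qweyl_actM reg_dx reg_xx reg_dd).
by rewrite (qweyl_act_x reg_dx reg_xx reg_dd).
Qed.

Lemma qweyl_coef_d i a : qweyl_coef (D i * a) = reg_d i (qweyl_coef a).
Proof.
rewrite /qweyl_coef (qweyl_actM reg_dx reg_xx reg_dd).
by rewrite (qweyl_act_d reg_dx reg_xx reg_dd).
Qed.

Lemma eq_incr_at t (g h : mi) : (h == incr_at t g) = (h t != 0%N) && (decr_at t h == g).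
Proof.
apply/eqP/andP => [->|[ht /eqP <-]]; last by rewrite decr_atK.
by rewrite incr_atK ffunE eqxx addn1.
Qed.

Lemma shift_delta t g : shift_at t (delta_at g) = delta_at (incr_at t g).
Proof.
by apply/funext => h; rewrite /shift_at /delta_at eq_incr_at; case: eqP.
Qed.

(** Induction on the total degree, peeling off an x from the left while one remains and then a d.
    Linear independence of the monomials follows. *)
Lemma qweyl_coef_mon g : qweyl_coef (qmon q g) = delta_at g.
Proof.
have [m] := ubnP (\sum_t g t); elim: m g => // m IH g; rewrite ltnS => gm.
have [[i gi]|gx] := EM (exists i, g (inl i) != 0%N).
  rewrite -(decr_atK gi) -x_qmon qweyl_coef_x IH; first exact: shift_delta.
  apply: leq_trans gm; rewrite (bigD1 (inl i)) //= [ltnRHS](bigD1 (inl i)) //=.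
  rewrite ffunE eqxx -addSn leq_add ?subn1 ?prednK ?lt0n //.
  by apply: leq_sum => t _; rewrite ffunE leq_subr.
have {}gx i : g (inl i) = 0%N by apply/eqP/negPn/negP => gi; apply: gx; exists i.
have [[i gi]|gd] := EM (exists i, g (inr i) != 0%N); last first.
  have -> : g = [ffun=> 0%N].
    apply/ffunP => -[i|i]; rewrite ffunE //.
    by apply/eqP/negPn/negP => gi; apply: gd; exists i.
  by rewrite qmon0 /qweyl_coef (qweyl_act1 reg_dx reg_xx reg_dd).
(* With no x present, d_i multiplies from the left without a factor and without a lower term,
   because q^0 = 1 and [qint q 0 = 0]. *)
have := d_qmon q i (decr_at (inr i) g).
rewrite !ffunE gx expr0 scale1r /qint big_ord0 scale0r addr0 (decr_atK gi) => <-.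
rewrite qweyl_coef_d IH.
  rewrite -[in RHS](decr_atK gi) -shift_delta; apply/funext => h; rewrite /reg_d.
  set u := shift_at _ _ _.
  rewrite /delta_at (_ : _ == _ = false) ?mulr0 ?addr0; last first.
    by apply/eqP => /ffunP /(_ (inl i)); rewrite !ffunE eqxx gx addn1.
  have [h0|h0] := eqVneq (h (inl i)) 0%N; first by rewrite h0 expr0 mul1r.
  rewrite /u shift_delta decr_atK // /delta_at (_ : _ == _ = false) ?mulr0 //.
  by apply/eqP => hg; move: h0; rewrite hg gx.
apply: leq_trans gm; rewrite (bigD1 (inr i)) //= [ltnRHS](bigD1 (inr i)) //=.
rewrite ffunE eqxx -addSn leq_add ?subn1 ?prednK ?lt0n //.
by apply: leq_sum => t _; rewrite ffunE leq_subr.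
Qed.

Lemma qweyl_coef_expand a : exists2 s : seq mi, uniq s &
  a = \sum_(g <- s) qweyl_coef a g *: qmon q g.
Proof.
have [s ->] := qmon_span a; exists (undup [seq p.2 | p : K * mi <- s]).
  exact: undup_uniq.
under [RHS]eq_bigr => g _ do rewrite qweyl_coef_sum scaler_suml.
rewrite [RHS]exchange_big /= big_seq [RHS]big_seq; apply: eq_bigr => p ps.
have p2s : p.2 \in undup [seq p.2 | p : K * mi <- s].
  by rewrite mem_undup; apply/mapP; exists p.
rewrite (bigD1_seq p.2) ?undup_uniq //= big1 ?addr0.
  by rewrite qweyl_coefZ qweyl_coef_mon /delta_at eqxx mulr1.
by move=> g gp; rewrite qweyl_coefZ qweyl_coef_mon /delta_at (negPf gp) mulr0 scale0r.
Qed.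

(** Centrality compares left with right multiplication, so the latter is computed on coefficients
    too; linearity reduces it to monomials. *)
Lemma qweyl_coef_mul_d a i : qweyl_coef (a * D i) = shift_at (inr i) (qweyl_coef a).
Proof.
have [s ->] := qmon_span a; apply/funext => h.
rewrite mulr_suml qweyl_coef_sum /shift_at qweyl_coef_sum.
transitivity (\sum_(p <- s) p.1 * shift_at (inr i) (delta_at p.2) h).
  apply: eq_bigr => p _.
  by rewrite -scalerAl qweyl_coefZ qmon_d qweyl_coef_mon shift_delta.
rewrite /shift_at; case: ifP => _; first by rewrite big1 // => p _; rewrite mulr0.
by apply: eq_bigr => p _; rewrite qweyl_coefZ qweyl_coef_mon.
Qed.

Lemma qweyl_coef_mul_x a i : qweyl_coef (a * X i) = fun h =>
  q ^+ h (inr i) * shift_at (inl i) (qweyl_coef a) h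
  + qint q (h (inr i)).+1 * qweyl_coef a (incr_at (inr i) h).
Proof.
have [s ->] := qmon_span a; apply/funext => h.
rewrite mulr_suml !qweyl_coef_sum /shift_at qweyl_coef_sum.
have -> : (if h (inl i) == 0%N then 0
    else \sum_(p <- s) qweyl_coef (p.1 *: qmon q p.2) (decr_at (inl i) h)) =
    \sum_(p <- s) p.1 * shift_at (inl i) (delta_at p.2) h.
  rewrite /shift_at; case: ifP => _; first by rewrite big1 // => p _; rewrite mulr0.
  by apply: eq_bigr => p _; rewrite qweyl_coefZ qweyl_coef_mon.
rewrite !mulr_sumr -big_split; apply: eq_bigr => -[c g] _ /=.
rewrite -scalerAl !qweyl_coefZ qmon_x qweyl_coefD !qweyl_coefZ !qweyl_coef_mon.
rewrite mulrDr shift_delta [in RHS]mulrCA [X in _ = _ + X]mulrCA; congr (c * _ + c * _).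
  rewrite /delta_at; case: (h =P _) => [->|_]; last by rewrite !mulr0.
  by rewrite ffunE addn0.
rewrite /delta_at [incr_at _ _ == _]eq_sym eq_incr_at [decr_at _ _ == _]eq_sym.
case: (g (inr i) =P 0%N) => [g0|/eqP g0]; first by rewrite g0 /qint big_ord0 mul0r mulr0.
case: (h =P _) => [->|_] /=; last by rewrite !mulr0.
by rewrite ffunE eqxx subn1 prednK // lt0n.
Qed.

(** * The center at a root of unity *)

Section Center.
Variable l : nat.
Hypotheses (hl : (1 < l)%N) (hq : l.-primitive_root q).

Lemma qint_neq0 m : ~~ (l %| m)%N -> qint q m != 0.
Proof.
move=> lm; apply/eqP => m0; have /esym/eqP := qintE q m.
by rewrite m0 mulr0 subr_eq0 -(prim_order_dvd hq) (negPf lm).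
Qed.

Lemma qint_dvd m : (l %| m)%N -> qint q m = 0.
Proof.
move=> lm; have /eqP := qintE q m.
have /eqP -> : q ^+ m == 1 by rewrite -(prim_order_dvd hq).
rewrite subrr mulf_eq0 subr_eq0 => /orP[|/eqP //].
rewrite -[q]expr1 -(prim_order_dvd hq) dvdn1 => /eqP l1.
by move: hl; rewrite l1.
Qed.

(** The hypothesis is commutation with one generator, read on coefficients. Induction on
    [h t = m + 1]: at [decr_at t h] it says q^m w + [m+1] c(h) = w. Either l divides m and q^m = 1,
    or w = 0 by induction; in both cases [m+1] c(h) = 0, and [m+1] is invertible. *)
Lemma shift_eq_supp t s (c : V) :
  (forall h : mi, q ^+ h t * shift_at s c h + qint q (h t).+1 * c (incr_at t h) =
    shift_at s c h) -> s != t ->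
  forall h : mi, ~~ (l %| h t)%N -> c h = 0.
Proof.
move=> E st h; move hm: (h t) => m; elim: m h hm => [|m IH] h hm lm.
  by rewrite dvdn0 in lm.
have ht : h t != 0%N by rewrite hm.
have := E (decr_at t h); rewrite (decr_atK ht) ffunE eqxx hm subn1 /=.
set w := shift_at _ _ _; suff -> : q ^+ m * w = w.
  move/eqP; rewrite -[X in _ == X]addr0 (inj_eq (addrI w)) mulf_eq0.
  by rewrite (negPf (qint_neq0 lm)) => /eqP.
have [lm'|lm'] := boolP (l %| m)%N.
  by have /eqP -> : q ^+ m == 1 by [rewrite -(prim_order_dvd hq)]; rewrite mul1r.
suff -> : w = 0 by rewrite mulr0.
rewrite /w /shift_at; case: ifP => // _; apply: IH => //.
by rewrite !ffunE eqxx eq_sym (negPf st) hm subn0 subn1.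
Qed.

(** Commuting with [D i] constrains the exponent of x_i, and commuting with [X i] that of d_i. *)
Lemma qweyl_center_supp (z : A) : center z ->
  forall g : mi, qweyl_coef z g != 0 -> forall t, (l %| g t)%N.
Proof.
move=> zC g zg t; apply: contraNT zg => lt; apply/eqP.
case: t lt => i lt.
  apply: (@shift_eq_supp (inl i) (inr i)) lt => // h.
  have /(congr1 (@qweyl_coef ^~ h)) /= := zC (D i).
  by rewrite qweyl_coef_mul_d qweyl_coef_d.
apply: (@shift_eq_supp (inr i) (inl i)) lt => // h.
have /(congr1 (@qweyl_coef ^~ h)) /= := zC (X i).
by rewrite qweyl_coef_mul_x qweyl_coef_x.
Qed.

End Center.
End RegularRep.

(** * The ideal m *)

Section CenterIdeal.
Variables (K : comNzRingType) (A : algType K).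

Lemma center1 : @center K A 1.
Proof. by move=> a; rewrite mul1r mulr1. Qed.

Lemma center_alg (c : K) : @center K A c%:A.
Proof. by move=> a; rewrite mulr_algl mulr_algr. Qed.

Lemma centerD (u v : A) : center u -> center v -> center (u + v).
Proof. by move=> zu zv a; rewrite mulrDl mulrDr zu zv. Qed.

Lemma centerB (u v : A) : center u -> center v -> center (u - v).
Proof. by move=> zu zv a; rewrite mulrBl mulrBr zu zv. Qed.

Lemma centerM (u v : A) : center u -> center v -> center (u * v).
Proof. by move=> zu zv a; rewrite -mulrA zv mulrA zu mulrA. Qed.

Variable G : set A.
Hypothesis GZ : G `<=` @center K A.

Lemma center_gen_idealP : center_ideal (center_gen_ideal G).
Proof.
split.
- move=> _ [t tP ->]; rewrite big_seq; elim/big_ind: _.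
  + by move=> a; rewrite mul0r mulr0.
  + exact: centerD.
  + by move=> p /tP[zp /GZ]; apply: centerM.
- by exists [::]; rewrite ?big_nil.
- move=> _ _ [s sP ->] [t tP ->]; exists (s ++ t); last by rewrite big_cat.
  by move=> p; rewrite mem_cat => /orP[/sP|/tP].
- move=> z _ zZ [t tP ->]; exists [seq (z * p.1, p.2) | p <- t].
    by move=> _ /mapP[p /tP[pZ Gp] ->]; split=> //; apply: centerM.
  by rewrite big_map mulr_sumr; apply: eq_bigr => p _; rewrite mulrA.
Qed.

Lemma center_gen_ideal_incl g : G g -> center_gen_ideal G g.
Proof.
move=> Gg; exists [:: (1, g)]; last by rewrite big_seq1 mul1r.
by move=> p; rewrite inE => /eqP ->; split=> //; apply: center1.
Qed.

End CenterIdeal.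

(** * Central elements congruent to scalars *)

Section ScalarModulo.
Variables (K : fieldType) (A : algType K) (m : set A).
Hypothesis mI : center_ideal m.

Definition scalar_mod (z : A) : Prop := center z /\ exists c : K, m (z - c%:A).

Lemma scalar_mod1 : scalar_mod 1.
Proof.
by split; [apply: center1 | exists 1; rewrite scale1r subrr; case: mI].
Qed.

Lemma scalar_modD u v : scalar_mod u -> scalar_mod v -> scalar_mod (u + v).
Proof.
move=> [zu [c mc]] [zv [d md]]; split; first exact: centerD.
exists (c + d); rewrite scalerDl opprD addrACA.
by case: mI => _ _ mD _; apply: mD.
Qed.

Lemma scalar_modM u v : scalar_mod u -> scalar_mod v -> scalar_mod (u * v).
Proof.
move=> [zu [c mc]] [zv [d md]]; split; first exact: centerM.
exists (c * d).
have -> : u * v - (c * d)%:A = u * (v - d%:A) + d%:A * (u - c%:A).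
  rewrite !mulrBr !mulr_algl mulr_algr scalerA [d * c]mulrC.
  by rewrite addrA subrK.
by case: mI => _ _ mD mM; apply: mD; apply: mM => //; apply: center_alg.
Qed.

Lemma scalar_modX u k : scalar_mod u -> scalar_mod (u ^+ k).
Proof.
move=> su; elim: k => [|k IH]; first exact: scalar_mod1.
by rewrite exprS; apply: scalar_modM.
Qed.

Lemma scalar_modZ k u : scalar_mod u -> scalar_mod (k *: u).
Proof.
move=> su; rewrite -mulr_algl; apply: scalar_modM su.
split; first exact: center_alg.
by exists k; rewrite subrr; case: mI.
Qed.

(** An ideal J strictly above m contains some w outside m. Its residue c is nonzero, and c itself
    lies in J, so J contains a unit. *)
Lemma center_max_scalar_mod :
  (forall z, center z -> scalar_mod z) -> ~ m 1 -> center_max_ideal m.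
Proof.
move=> sm m1; split=> //; first by move=> mE; apply: m1; rewrite mE; apply: center1.
move=> J JI mJ; have [Jm|Jm] := EM (J `<=` m); first by left; apply/seteqP.
right; case: JI => JZ J0 JD JM; apply/seteqP; split=> // z zZ.
have [w Jw mw] : exists2 w, J w & ~ m w.
  apply: contrapT => nw; apply: Jm => w Jw; apply: contrapT => mw.
  by apply: nw; exists w.
have [_ [c mc]] := sm _ (JZ _ Jw).
have c0 : c != 0 by apply: contra_notN mw => /eqP c0; move: mc; rewrite c0 scale0r subr0.
have Jc : J c%:A.
  have -> : c%:A = w + (-1)%:A * (w - c%:A) by rewrite mulr_algl scaleN1r opprB subrKC.
  by apply: JD => //; apply: JM; [apply: center_alg | apply: mJ].
have -> : z = (c^-1 *: z) * c%:A by rewrite mulr_algr scalerA mulfV ?scale1r.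
by apply: JM => //; rewrite -mulr_algl; apply: centerM zZ; apply: center_alg.
Qed.

End ScalarModulo.

(** * Reduction of exponents modulo m *)

Section QweylIdeal.
Variables (K : fieldType) (n l : nat) (q : K) (a b : 'I_n -> K).
Hypotheses (hl : (1 < l)%N) (hq : l.-primitive_root q).

Local Notation A := (qweyl n q).
Local Notation X := (@qweyl_x K n q).
Local Notation D := (@qweyl_d K n q).
Local Notation mi := {ffun 'I_n + 'I_n -> nat}.

Definition qweyl_gens : set A :=
  range (fun i => X i ^+ l - (a i)%:A) `|` range (fun i => D i ^+ l - (b i)%:A).

Local Notation m := (center_gen_ideal qweyl_gens).

Lemma qweyl_centerP (z : A) :
  (forall i, z * X i = X i * z) -> (forall i, z * D i = D i * z) -> center z.
Proof.
move=> zX zD; elim/qweyl_ind => [|u v Eu Ev|c u Eu|i u Eu|i u Eu].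
- by rewrite mul1r mulr1.
- by rewrite mulrDr mulrDl Eu Ev.
- by rewrite -scalerAr -scalerAl Eu.
- by rewrite mulrA zX -mulrA Eu mulrA.
- by rewrite mulrA zD -mulrA Eu mulrA.
Qed.

(** In the q-Leibniz rule for the l-th power, q^l = 1 and [qint q l = 0]. *)
Lemma qweyl_x_expl_center i : center (X i ^+ l).
Proof.
apply: qweyl_centerP => j; apply/esym.
  by apply: commrX; apply: qweyl_xx.
have [->|ij] := eqVneq j i.
  rewrite (qpair_dXn (qweyl_dx_eq q i)) (prim_expr_order hq) scale1r.
  by rewrite (qint_dvd hl hq) // scale0r addr0.
by apply: commrX; apply: qweyl_dx_neq.
Qed.

Lemma qweyl_d_expl_center i : center (D i ^+ l).
Proof.
apply: qweyl_centerP => j; last by apply/esym/commrX; apply: qweyl_dd.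
have [->|ij] := eqVneq j i.
  rewrite (qpair_dnX (qweyl_dx_eq q i)) (prim_expr_order hq) scale1r.
  by rewrite (qint_dvd hl hq) // scale0r addr0.
by apply/esym; apply: commrX; rewrite /GRing.comm qweyl_dx_neq // eq_sym.
Qed.

Lemma qweyl_gens_center : qweyl_gens `<=` @center K A.
Proof.
move=> _ [] [i _ <-]; apply: centerB; try exact: center_alg.
  exact: qweyl_x_expl_center.
exact: qweyl_d_expl_center.
Qed.

Let mI := center_gen_idealP qweyl_gens_center.

Lemma scalar_mod_x i : scalar_mod m (X i ^+ l).
Proof.
split; first exact: qweyl_x_expl_center.
by exists (a i); apply: center_gen_ideal_incl; left; exists i.
Qed.

Lemma scalar_mod_d i : scalar_mod m (D i ^+ l).
Proof.
split; first exact: qweyl_d_expl_center.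
by exists (b i); apply: center_gen_ideal_incl; right; exists i.
Qed.

Lemma scalar_mod_qmon (g : mi) : (forall t, (l %| g t)%N) -> scalar_mod m (qmon q g).
Proof.
move=> lg; apply: (scalar_modM mI); elim/big_ind: _ => [||i _].
- exact: scalar_mod1.
- exact: (scalar_modM mI).
- rewrite -(divnK (lg (inl i))) mulnC exprM.
  by apply: (scalar_modX mI); apply: scalar_mod_x.
- exact: scalar_mod1.
- exact: (scalar_modM mI).
- rewrite -(divnK (lg (inr i))) mulnC exprM.
  by apply: (scalar_modX mI); apply: scalar_mod_d.
Qed.

(** Only monomials with all exponents divisible by l occur in z; they are products of powers of the
    x_i^l and d_i^l, which are scalars modulo m. *)
Lemma scalar_mod_center z : center z -> scalar_mod m z.
Proof.
move=> zZ; have [s _ ->] := qweyl_coef_expand z.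
elim/big_ind: _ => [||g _].
- by rewrite -(scale0r (1 : A)); apply: (scalar_modZ mI); apply: scalar_mod1.
- exact: (scalar_modD mI).
have [->|g0] := eqVneq (qweyl_coef z g) 0.
  by rewrite scale0r -(scale0r (1 : A)); apply: (scalar_modZ mI); apply: scalar_mod1.
apply: (scalar_modZ mI); apply: scalar_mod_qmon.
exact: (qweyl_center_supp hq zZ g0).
Qed.

Lemma qweyl_ideal_max : ~ m 1 -> center_max_ideal m.
Proof. exact: (center_max_scalar_mod mI scalar_mod_center). Qed.

(** Exponents split into a remainder [g0] and a multiple [g1] of l, and the monomial of [g1] is a
    central scalar c modulo m. *)
Lemma qmon_modn (g : mi) : exists c : K,
  gen_ideal m (qmon q g - c *: qmon q [ffun t => g t %% l]%N).
Proof.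
pose g0 : mi := [ffun t => g t %% l]%N; pose g1 : mi := [ffun t => g t %/ l * l]%N.
have [g1Z [c mc]] : scalar_mod m (qmon q g1).
  by apply: scalar_mod_qmon => t; rewrite ffunE dvdn_mull.
exists c; have -> : qmon q g = qmon q g0 * qmon q g1.
  (* Gathering the [g1] part on the right only requires moving its x-factors past the d-factors of
     [g0]. *)
  have dX : center (\prod_i X i ^+ g1 (inl i)).
    elim/big_ind: _ => [||i _]; [exact: center1 | exact: centerM |].
    rewrite ffunE mulnC exprM; elim: (_ %/ _)%N => [|k IH]; first exact: center1.
    by rewrite exprS; apply: centerM IH; apply: qweyl_x_expl_center.
  have -> : qmon q g = ((\prod_i X i ^+ g0 (inl i)) * \prod_i X i ^+ g1 (inl i))
      * ((\prod_i D i ^+ g0 (inr i)) * \prod_i D i ^+ g1 (inr i)).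
    rewrite -(prod_exprD (@qweyl_xx K n q)) -(prod_exprD (@qweyl_dd K n q)).
    by congr (_ * _); apply: eq_bigr => i _; rewrite !ffunE addnC -divn_eq.
  rewrite /qmon; move: dX; set u := \prod_i X i ^+ g1 _ => dX.
  set v := \prod_i X i ^+ _; set w := \prod_i D i ^+ g0 _.
  by rewrite -[LHS]mulrA [in LHS](mulrA u) dX !mulrA.
rewrite -/g0 -mulr_algr -mulrBr; apply: gen_idealMl; exact: gen_ideal_incl.
Qed.

Lemma qmon_span_mod (u : A) : exists k : {ffun 'I_n + 'I_n -> 'I_l} -> K,
  gen_ideal m (u - \sum_s k s *: qmon q [ffun t => s t : nat]).
Proof.
have [s ->] := qmon_span u; elim: s => [|[c g] s [k mk]].
  exists (fun=> 0); rewrite big_nil sub0r big1 ?oppr0; first exact: gen_ideal0.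
  by move=> s _; rewrite scale0r.
have [d md] := qmon_modn g.
have l0 : (0 < l)%N by apply: ltnW.
pose h : {ffun 'I_n + 'I_n -> 'I_l} := [ffun t => Ordinal (ltn_pmod (g t) l0)].
(* The new term c x^g reduces to c d times the monomial with exponents [h], so only the coefficient
   at [h] changes. *)
exists (fun s => (if s == h then c * d else 0) + k s).
under [X in _ - X]eq_bigr => r _ do rewrite scalerDl.
rewrite big_split /= big_cons opprD addrACA; apply: gen_idealD => //=.
rewrite (bigD1 h) //= eqxx big1 ?addr0; last first.
  by move=> r /negPf ->; rewrite scale0r.
rewrite -scalerA -scalerBr -mulr_algl; apply: gen_idealMl.
suff -> : [ffun t => h t : nat] = [ffun t => g t %% l]%N :> mi by [].
by apply/ffunP => t; rewrite !ffunE.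
Qed.

End QweylIdeal.

(** * Necessity *)

Section MatrixFacts.
Variables (K : fieldType) (N : nat).

(** Every row vector has the form v B, since some coordinate of v is invertible; hence U kills all
    of them. *)
Lemma mx_invariant_kernel (U : 'M[K]_N) (v : 'rV_N) : v != 0 ->
  (forall B : 'M_N, v *m B *m U = 0) -> U = 0.
Proof.
move=> /rV0Pn[k vk] vBU; apply/row_matrixP => j; rewrite row0 rowE.
have -> : delta_mx 0 j = v *m ((v 0 k)^-1 *: delta_mx k j) :> 'rV_N.
  apply/rowP => s; rewrite -scalemxAr !mxE (bigD1 k) //= big1 ?addr0.
    by rewrite !mxE !eqxx /= mulrA mulVf ?mul1r.
  by move=> r /negPf rk; rewrite !mxE rk mulr0.
exact: vBU.
Qed.

Lemma mx_central_scalar (U : 'M[K]_N) :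
  (forall B, U *m B = B *m U) -> exists c, U = c%:M.
Proof.
case: N U => [|N'] U UC; first by exists 0; apply/matrixP => -[].
exists (U 0 0); apply/matrixP => i j.
(* Commuting with the matrix unit E_j0 and comparing entries (i, 0) forces U_ij to be U_00 for i = j
   and 0 otherwise. *)
have /matrixP /(_ i 0) := UC (delta_mx j 0).
rewrite !mxE (bigD1 j) //= big1; last by move=> r /negPf rj; rewrite !mxE rj mulr0.
rewrite mxE !eqxx mulr1 addr0 => ->.
rewrite (bigD1 0) //= big1; last first.
  by move=> r /negPf r0; rewrite !mxE r0 andbF mul0r.
by rewrite mxE eqxx andbT addr0 mulrC mulr_natr.
Qed.

End MatrixFacts.

(** * The obstruction from a nilpotent normal element *)

Section NotAzumaya.
Variables (K : fieldType) (n l N : nat) (q : K) (a b : 'I_n -> K).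
Hypotheses (hl : (1 < l)%N) (hq : l.-primitive_root q) (N_gt0 : (0 < N)%N).

Local Notation A := (qweyl n q).
Local Notation X := (@qweyl_x K n q).
Local Notation D := (@qweyl_d K n q).
Local Notation m := (center_gen_ideal (@qweyl_gens K n l q a b)).

(** [phi] models the projection to A/(m) followed by an isomorphism onto matrices: a surjective
    algebra map with kernel exactly (m). *)
Variable phi : A -> 'M[K]_N.
Hypotheses (phiD : forall u v, phi (u + v) = phi u + phi v)
  (phiZ : forall (c : K) u, phi (c *: u) = c *: phi u)
  (phi1 : phi 1 = 1%:M) (phiM : forall u v, phi (u * v) = phi u *m phi v)
  (phi_surj : forall B, exists u, phi u = B)
  (phi_ker : forall u, phi u = 0 <-> gen_ideal m u).

Lemma qeuler_normal i (g : A) : (exists j, g = X j \/ g = D j) ->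
  exists c, g * qeuler q (X i) (D i) = c *: (qeuler q (X i) (D i) * g).
Proof.
have q0 := prim_root_neq0 hq.
move=> [j [->|->]]; (have [->|ij] := eqVneq j i).
- exists q^-1; rewrite (qeuler_x (qweyl_dx_eq q i)).
  by rewrite scalerA mulVf ?scale1r.
- exists 1; rewrite scale1r; apply: qeuler_comm; first exact: qweyl_xx.
  by rewrite qweyl_dx_neq // eq_sym.
- by exists q; rewrite (qeuler_d (qweyl_dx_eq q i)).
- exists 1; rewrite scale1r; apply: qeuler_comm; last exact: qweyl_dd.
  exact: qweyl_dx_neq.
Qed.

Lemma phi_expl_x i : phi (X i ^+ l) = (a i)%:M.
Proof.
apply/eqP; rewrite -subr_eq0 -scalemx1 -scaleNr -phi1 -phiZ -phiD scaleNr.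
by apply/eqP/phi_ker/gen_ideal_incl/center_gen_ideal_incl; left; exists i.
Qed.

Lemma phi_expl_d i : phi (D i ^+ l) = (b i)%:M.
Proof.
apply/eqP; rewrite -subr_eq0 -scalemx1 -scaleNr -phi1 -phiZ -phiD scaleNr.
by apply/eqP/phi_ker/gen_ideal_incl/center_gen_ideal_incl; right; exists i.
Qed.

Lemma q_sub1_neq0 : 1 - q != 0.
Proof.
rewrite subr_eq0 eq_sym -[q]expr1 -(prim_order_dvd hq) dvdn1.
by apply/eqP => l1; move: hl; rewrite l1.
Qed.

(** The left kernel of the image of u_i is nonzero, and u_i commutes with each generator up to a
    scalar, so this kernel is stable under all matrices. *)
Lemma phi_euler0 i : a i * b i = (1 - q) ^- l -> phi (qeuler q (X i) (D i)) = 0.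
Proof.
move=> ab; set u := qeuler _ _ _.
have phiB (s t : A) : phi (s - t) = phi s - phi t.
  by rewrite -[- t]scaleN1r phiD phiZ scaleN1r.
have ul : phi (u ^+ l) = 0.
  (* The hypothesis gives (1 - q)^l a_i b_i = 1, so 1 - u^l maps to 1. *)
  have := congr1 phi (qeuler_expl (qweyl_dx_eq q i) hq); rewrite -/u.
  rewrite phiZ phiM phi_expl_x phi_expl_d -scalar_mxM ab scale_scalar_mx.
  rewrite mulfV ?expf_neq0 ?q_sub1_neq0 // phiB phi1 => /eqP.
  by rewrite -subr_eq0 opprB addrCA subrr addr0 => /eqP.
have [v v0 vu] : exists2 v : 'rV_N, v != 0 & v *m phi u = 0.
  (* The determinant of the image of u vanishes because its l-th power does. *)
  apply/det0P; have : \det (phi (u ^+ l)) = 0.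
    by case: N N_gt0 phi ul => // N' _ phi' ->; rewrite det0.
  elim: l => [|k IH]; first by rewrite phi1 det1 => /eqP; rewrite oner_eq0.
  by rewrite exprS phiM det_mulmx => /eqP; rewrite mulf_eq0 => /orP[|/eqP/IH].
apply: mx_invariant_kernel v0 _ => B; have [s <-] := phi_surj B.
have gen_case (g : A) w : (exists j, g = X j \/ g = D j) ->
    w *m phi u = 0 -> w *m phi g *m phi u = 0.
  move=> /(qeuler_normal i)[c E] wu; rewrite -mulmxA -phiM E phiZ phiM.
  by rewrite -scalemxAr mulmxA wu mul0mx scaler0.
elim/qweyl_ind: s v vu => [|s t Es Et|c s Es|j s Es|j s Es] v vu.
- by rewrite phi1 mulmx1.
- by rewrite phiD mulmxDr mulmxDl Es // Et // addr0.
- by rewrite phiZ -scalemxAr -scalemxAl Es // scaler0.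
- rewrite phiM mulmxA; apply: Es; apply: gen_case => //; by exists j; left.
- rewrite phiM mulmxA; apply: Es; apply: gen_case => //; by exists j; right.
Qed.

(* A acts on the matrices through the twist x_j -> q x_j, d_j -> q^-1 d_j. *)
Let tx j (B : 'M[K]_N) : 'M[K]_N := q *: (phi (X j) *m B).
Let td j (B : 'M[K]_N) : 'M[K]_N := q^-1 *: (phi (D j) *m B).

Let tx_linear j : linear (tx j).
Proof. by move=> c u v; rewrite /tx linearP /= scalerDr !scalerA mulrC. Qed.
Let td_linear j : linear (td j).
Proof. by move=> c u v; rewrite /td linearP /= scalerDr !scalerA mulrC. Qed.

HB.instance Definition _ j := GRing.isLinear.Build K _ _ *:%R (tx j) (tx_linear j).
HB.instance Definition _ j := GRing.isLinear.Build K _ _ *:%R (td j) (td_linear j).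

Let tdx i j B : td i (tx j B) = q ^+ (i == j) *: tx j (td i B) + B *+ (i == j).
Proof.
have q0 := prim_root_neq0 hq.
rewrite /tx /td -!scalemxAr !mulmxA -!phiM !scalerA mulVf // mulfK // scale1r.
have [<-|ij] := eqVneq i j; last by rewrite scale1r addr0 qweyl_dx_neq.
by rewrite qweyl_dx_eq phiD phiZ phi1 mulmxDl mul1mx scalemxAl.
Qed.

Let txx i j B : tx i (tx j B) = tx j (tx i B).
Proof. by rewrite /tx -!scalemxAr !mulmxA -!phiM qweyl_xx. Qed.

Let tdd i j B : td i (td j B) = td j (td i B).
Proof. by rewrite /td -!scalemxAr !mulmxA -!phiM qweyl_dd. Qed.

(** The twisted action still kills m because q^l = 1. The element x_i - c lies in (m), and applying
    it to the identity matrix gives q c - c = 0. *)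
Lemma phi_x_scalar i c : phi (X i) = c%:M -> c = 0.
Proof.
move=> Xc; have q0 := prim_root_neq0 hq.
have act_x k j B : qweyl_act tx td (X j ^+ k) B = q ^+ k *: (phi (X j ^+ k) *m B).
  elim: k B => [|k IH] B; first by rewrite (qweyl_act1 tdx txx tdd) scale1r phi1 mul1mx.
  rewrite exprS (qweyl_actM tdx txx tdd) IH (qweyl_act_x tdx txx tdd) /= /tx.
  by rewrite -scalemxAr scalerA -exprS mulmxA -phiM.
have act_d k j B : qweyl_act tx td (D j ^+ k) B = q ^- k *: (phi (D j ^+ k) *m B).
  elim: k B => [|k IH] B.
    by rewrite (qweyl_act1 tdx txx tdd) invr1 scale1r phi1 mul1mx.
  rewrite exprS (qweyl_actM tdx txx tdd) IH (qweyl_act_d tdx txx tdd) /= /td.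
  by rewrite -scalemxAr scalerA exprS invfM mulmxA -phiM.
have act_sub (u : A) (k : K) B :
    qweyl_act tx td (u - k%:A) B = qweyl_act tx td u B - k *: B.
  rewrite -scaleNr (qweyl_actDl tdx txx tdd) (qweyl_actZl tdx txx tdd).
  by rewrite (qweyl_act1 tdx txx tdd) scaleNr.
have : gen_ideal m (X i - c%:A).
  apply/phi_ker; rewrite -scaleNr phiD phiZ phi1 Xc scalemx1.
  by rewrite raddfN /= subrr.
move/(@qweyl_act_center_gen_ideal _ _ _ _ _ _ tdx txx tdd _ _ 1%:M) => E.
have {E} : qweyl_act tx td (X i - c%:A) 1%:M = 0.
  apply: E => _ B [] [j _ <-]; rewrite act_sub.
    rewrite act_x phi_expl_x (prim_expr_order hq) scale1r.
    by rewrite mul_scalar_mx subrr.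
  rewrite act_d phi_expl_d (prim_expr_order hq) invr1 scale1r.
  by rewrite mul_scalar_mx subrr.
rewrite act_sub -[X i]expr1 act_x !expr1 Xc mulmx1.
rewrite scalemx1 scale_scalar_mx => /matrixP /(_ (Ordinal N_gt0) (Ordinal N_gt0)).
rewrite !mxE eqxx !mulr1n => /eqP.
rewrite -[X in _ - X]mul1r -mulrBl mulf_eq0 -oppr_eq0 opprB.
by rewrite (negPf q_sub1_neq0) => /eqP.
Qed.

Lemma azumaya_neq i : a i * b i != (1 - q) ^- l.
Proof.
apply/eqP => /phi_euler0 u0.
have xd : (1 - q) *: (phi (X i) *m phi (D i)) = 1%:M.
  move: u0; rewrite /qeuler phiD phiZ phi1 phiM => /eqP.
  by rewrite addr_eq0 -scaleNr opprB => /eqP.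
(* Replacing 1 by (1 - q) x d in d x = q x d + 1 gives d x = x d. *)
have dx : phi (D i) *m phi (X i) = phi (X i) *m phi (D i).
  rewrite -!phiM qweyl_dx_eq phiD phiZ phi1 -xd -phiM.
  by rewrite -scalerDl addrCA subrr addr0 scale1r.
(* Now the image of x_i commutes with the images of all generators, so it is central in the matrix
   algebra. *)
have [c Xc] : exists c, phi (X i) = c%:M.
  apply: mx_central_scalar => B; have [s <-] := phi_surj B.
  rewrite -!phiM; elim/qweyl_ind: s => [|s t Es Et|c s Es|j s Es|j s Es].
  - by rewrite mulr1 mul1r.
  - by rewrite mulrDr mulrDl !phiD Es Et.
  - by rewrite -scalerAr -scalerAl !phiZ Es.
  - by rewrite mulrA qweyl_xx -mulrA -[_ * s * _]mulrA !(phiM (X j)) Es.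
  rewrite mulrA phiM [phi (X i * _)]phiM.
  have -> : phi (X i) *m phi (D j) = phi (D j) *m phi (X i).
    by have [->|ij] := eqVneq j i; [rewrite dx | rewrite -!phiM qweyl_dx_neq].
  by rewrite -mulmxA -phiM Es -[D j * s * _]mulrA [RHS]phiM.
move: xd; rewrite Xc (phi_x_scalar Xc) raddf0 mul0mx scaler0.
move=> /matrixP /(_ (Ordinal N_gt0) (Ordinal N_gt0)).
by rewrite !mxE eqxx => /eqP; rewrite eq_sym oner_eq0.
Qed.

End NotAzumaya.

(** * Weight modules *)

Section WeightParameters.
Variables (K : closedFieldType) (l : nat) (q : K).
Hypotheses (hl : (1 < l)%N) (hq : l.-primitive_root q).

(** The eigenvalue of x d on the k-th basis vector, chosen so that u = 1 + (q - 1) x d has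
    eigenvalue mu q^k. *)
Definition weight (mu : K) (k : nat) : K := (mu * q ^+ k - 1) / (q - 1).

Let q1 : q - 1 != 0.
Proof. by rewrite -oppr_eq0 opprB (q_sub1_neq0 hl hq). Qed.

Lemma weightS mu k : weight mu k.+1 = q * weight mu k + 1.
Proof. by rewrite /weight exprS; field. Qed.

Lemma weight_mod mu k : weight mu (k %% l) = weight mu k.
Proof. by rewrite /weight (prim_expr_mod hq). Qed.

Lemma weight_euler mu k : 1 + (q - 1) * weight mu k = mu * q ^+ k.
Proof. by rewrite /weight; field. Qed.

Lemma prod_weight mu :
  (1 - q) ^+ l * \prod_(k < l) weight mu k = 1 - mu ^+ l.
Proof.
have q0 := prim_root_neq0 hq.
(* The product identity involves inverse powers of its root, so it is applied to q^-1 and evaluated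
   at mu. *)
have hqV : l.-primitive_root q^-1.
  have -> : q^-1 = q ^+ l.-1.
    apply: (mulfI q0); rewrite mulfV // -exprS prednK ?(prim_order_gt0 hq) //.
    by rewrite (prim_expr_order hq).
  by rewrite (prim_root_exp_coprime _ hq) coprimePn ?(prim_order_gt0 hq).
have /(congr1 (fun p => p.[mu])) := prod_1_sub_prim_expr hqV.
rewrite horner_prod !hornerE => <-.
have E k : (1 - q) * weight mu k = 1 - mu * q ^+ k by rewrite /weight; field.
transitivity (\prod_(k < l) ((1 - q) * weight mu k)).
  by rewrite [RHS]big_split /= prodr_const card_ord.
by apply: eq_bigr => k _; rewrite E !hornerE exprVn invrK mulrC.
Qed.

(* x sends the k-th basis vector to the next one, with coefficient a when it
   wraps around and 1 otherwise; d sends it to the previous one, with coefficient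
   r when it wraps around and weight mu k otherwise.  For a = 0 only d can be used
   to go down, whence the last condition. *)
Definition weight_params (a b mu r : K) : Prop :=
  [/\ mu != 0, a * r = weight mu 0, r * \prod_(k < l.-1) weight mu k.+1 = b
    & a = 0 -> forall k, (0 < k < l)%N -> weight mu k != 0].

Lemma weight_params_exist a b : a * b != (1 - q) ^- l ->
  exists mu r, weight_params a b mu r.
Proof.
move=> ab; have l0 : (0 < l)%N by apply: ltnW.
have nz : (1 - q) ^+ l != 0 by rewrite expf_neq0 // (q_sub1_neq0 hl hq).
have [a0|a0] := eqVneq a 0; last first.
  (* For a nonzero, mu is an l-th root of 1 - (1 - q)^l a b, which is nonzero by hypothesis. Then r
     is forced by a r = weight 0, and [prod_weight] yields the condition on b. *)
  have [mu mul] : exists mu : K, mu ^+ l = 1 - (1 - q) ^+ l * (a * b).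
    have [mu E] := solve_monicpoly
      (fun k => if k == 0%N then 1 - (1 - q) ^+ l * (a * b) else 0) l0.
    exists mu; rewrite E; case: (l) l0 => // l' _; rewrite big_ord_recl expr0 mulr1.
    by rewrite big1 ?addr0 // => k _; rewrite mul0r.
  have mu0 : mu != 0.
    apply: contraNneq ab => mu0; move/eqP: mul.
    rewrite mu0 expr0n (gtn_eqF l0) eq_sym subr_eq0 => /eqP E.
    by apply/eqP/(mulfI nz); rewrite -E mulfV.
  exists mu, (weight mu 0 / a); split=> //.
  - by rewrite mulrC divfK.
  - have := prod_weight mu; rewrite mul subKr.
    move/(mulfI nz).
    case: (l) l0 => // l' _; rewrite big_ord_recl => E.
    by apply: (mulfI a0); rewrite -E mulrA [a * _]mulrC divfK.
  - by move/eqP; rewrite (negPf a0).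
(* For a = 0 the choice mu = 1 makes weight 0 vanish, as a r = 0 demands, and keeps the weights at 0
   < k < l nonzero; r is then fitted to b. *)
have t0 : weight 1 0 = 0 by rewrite /weight expr0 mulr1 subrr mul0r.
have tk k : (0 < k < l)%N -> weight 1 k != 0.
  move=> /andP[k0 kl]; rewrite /weight mul1r mulf_neq0 ?invr_eq0 //.
  by rewrite subr_eq0 -(prim_order_dvd hq) gtnNdvd.
have P0 : \prod_(k < l.-1) weight 1 k.+1 != 0.
  apply/prodf_neq0 => k _; apply: tk => /=.
  by rewrite -[X in (_ < X)%N](prednK l0) ltnS.
exists 1, (b / \prod_(k < l.-1) weight 1 k.+1); split=> //.
- exact: oner_neq0.
- by rewrite a0 mul0r t0.
- by rewrite divfK.
Qed.

End WeightParameters.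

(** * Cyclic shifts of the basis indices *)

Section SetCoord.
Variables (n l : nat).
Hypothesis l_gt0 : (0 < l)%N.

Local Notation I := {ffun 'I_n -> 'I_l}.

Definition set_coord (s : I) (i : 'I_n) (k : nat) : I :=
  [ffun j => if j == i then Ordinal (ltn_pmod k l_gt0) else s j].

Lemma set_coord_eq (s : I) i k : set_coord s i k i = (k %% l)%N :> nat.
Proof. by rewrite ffunE eqxx. Qed.

Lemma set_coord_neq (s : I) i j k : j != i -> set_coord s i k j = s j.
Proof. by move=> /negPf ji; rewrite ffunE ji. Qed.

Lemma set_coord_mod (s : I) i j k : (j %% l = k %% l)%N ->
  set_coord s i j = set_coord s i k.
Proof.
by move=> jk; apply/ffunP => r; rewrite !ffunE; case: eqP => // _; apply/val_inj.
Qed.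

Lemma set_coord_set (s : I) i j k : set_coord (set_coord s i j) i k = set_coord s i k.
Proof. by apply/ffunP => r; rewrite !ffunE; case: eqP. Qed.

Lemma set_coord_id (s : I) i : set_coord s i (s i) = s.
Proof.
apply/ffunP => r; rewrite !ffunE; case: eqP => // ->.
by apply/val_inj; rewrite /= modn_small.
Qed.

Lemma set_coordC (s : I) i j k m : i != j ->
  set_coord (set_coord s i k) j m = set_coord (set_coord s j m) i k.
Proof.
move=> /negPf ij; apply/ffunP => r; rewrite !ffunE.
by case: (r =P j) => [->|//]; rewrite eq_sym ij.
Qed.

Definition incr_coord (s : I) i := set_coord s i (s i).+1.
(** Adding [l.-1] subtracts 1 modulo l without truncation at 0. *)
Definition decr_coord (s : I) i := set_coord s i (s i + l.-1).

Lemma incr_coordK (s : I) i : decr_coord (incr_coord s i) i = s.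
Proof.
rewrite /decr_coord set_coord_set -[RHS](set_coord_id s i); apply: set_coord_mod.
by rewrite set_coord_eq modnDml addSnnS prednK // modnDr.
Qed.

Lemma decr_coordK (s : I) i : incr_coord (decr_coord s i) i = s.
Proof.
rewrite /incr_coord set_coord_set -[RHS](set_coord_id s i); apply: set_coord_mod.
by rewrite set_coord_eq -addn1 modnDml -addnA addn1 prednK // modnDr.
Qed.

Lemma incr_coord_set (s : I) i k : incr_coord (set_coord s i k) i = set_coord s i k.+1.
Proof.
rewrite /incr_coord set_coord_set; apply: set_coord_mod.
by rewrite set_coord_eq -addn1 modnDml addn1.
Qed.

Lemma decr_coord_set (s : I) i k : decr_coord (set_coord s i k.+1) i = set_coord s i k.
Proof. by rewrite -incr_coord_set incr_coordK. Qed.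

Lemma coord_eq0 (s : I) i : (s i == 0%N :> nat) = ((decr_coord s i i).+1 == l).
Proof.
rewrite set_coord_eq; case: (s i) => -[|k] kl /=.
  by rewrite add0n modn_small ?ltn_predL // prednK // !eqxx.
rewrite addSnnS prednK // modnDr modn_small; last exact: ltnW.
by rewrite (ltn_eqF kl).
Qed.

Lemma incr_coord_eq0 (s : I) i : (incr_coord s i i == 0%N :> nat) = ((s i).+1 == l).
Proof. by rewrite coord_eq0 incr_coordK. Qed.

End SetCoord.

(** * The weight module and its surjectivity onto matrices *)

Section WeightModule.
Variables (K : closedFieldType) (n l : nat) (q : K) (a b mu r : 'I_n -> K).
Hypotheses (hl : (1 < l)%N) (hq : l.-primitive_root q).
Hypothesis abP : forall i, weight_params l q (a i) (b i) (mu i) (r i).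

Let l_gt0 : (0 < l)%N := ltnW hl.

Local Notation A := (qweyl n q).
Local Notation X := (@qweyl_x K n q).
Local Notation D := (@qweyl_d K n q).
Local Notation I := {ffun 'I_n -> 'I_l}.
Local Notation V := {ffun I -> K^o}.
Local Notation incr := (incr_coord l_gt0).
Local Notation decr := (decr_coord l_gt0).
Local Notation setc := (set_coord l_gt0).
Local Notation t := (fun i => weight q (mu i)).

(** Both coefficients are indexed by the target: [wx_coef i k] belongs to the step from k - 1 to k,
    and [wd_coef i k] to the step from k + 1 to k, modulo l. *)
Definition wx_coef i (k : nat) : K := if k == 0%N then a i else 1.
Definition wd_coef i (k : nat) : K := if k.+1 == l then r i else t i k.+1.

Definition wmod_x i (v : V) : V :=
  [ffun s : I => wx_coef i (s i) * v (decr s i)].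
Definition wmod_d i (v : V) : V :=
  [ffun s : I => wd_coef i (s i) * v (incr s i)].

Lemma wmod_xE i v s : wmod_x i v s = wx_coef i (s i) * v (decr s i).
Proof. by rewrite ffunE. Qed.

Lemma wmod_dE i v s : wmod_d i v s = wd_coef i (s i) * v (incr s i).
Proof. by rewrite ffunE. Qed.

Lemma wmod_x_linear i : linear (wmod_x i).
Proof.
move=> c u v; apply/ffunP => s; rewrite !ffunE mulrDr; congr (_ + _).
by rewrite /GRing.scale /= mulrCA.
Qed.

Lemma wmod_d_linear i : linear (wmod_d i).
Proof.
move=> c u v; apply/ffunP => s; rewrite !ffunE mulrDr; congr (_ + _).
by rewrite /GRing.scale /= mulrCA.
Qed.

HB.instance Definition _ i :=
  GRing.isLinear.Build K V V *:%R (wmod_x i) (wmod_x_linear i).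
HB.instance Definition _ i :=
  GRing.isLinear.Build K V V *:%R (wmod_d i) (wmod_d_linear i).

(** Away from the wrap-around the coefficient of x is 1; at the wrap-around the product is a r =
    weight 0, which is weight l since q^l = 1. *)
Lemma wcoefM (s : I) i : wd_coef i (s i) * wx_coef i (incr s i i) = t i (s i).+1.
Proof.
rewrite /wd_coef /wx_coef incr_coord_eq0; case: eqP => [sl|_]; last by rewrite mulr1.
have [_ ar _ _] := abP i.
by rewrite mulrC ar -[in RHS](weight_mod hq) sl modnn.
Qed.

Lemma wmod_dxE i v (s : I) : wmod_d i (wmod_x i v) s = t i (s i).+1 * v s.
Proof. by rewrite wmod_dE wmod_xE incr_coordK mulrA wcoefM. Qed.

Lemma wmod_xdE i v (s : I) : wmod_x i (wmod_d i v) s = t i (s i) * v s.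
Proof.
have := wcoefM (decr s i) i; rewrite decr_coordK => E.
rewrite wmod_xE wmod_dE decr_coordK mulrA [wx_coef _ _ * _]mulrC E; congr (_ * _).
rewrite -(weight_mod hq) -[in RHS](weight_mod hq) set_coord_eq.
by rewrite -addn1 modnDml -addnA addn1 prednK // modnDr.
Qed.

Lemma wmod_dx i j v : wmod_d i (wmod_x j v) =
  q ^+ (i == j) *: wmod_x j (wmod_d i v) + v *+ (i == j).
Proof.
have [<-|ij] := eqVneq i j; apply/ffunP => s.
  rewrite wmod_dxE ffunE [(_ *: wmod_x _ _) s]ffunE wmod_xdE.
  by rewrite [_ *: _]mulrA (weightS hl hq) mulrDl mul1r.
rewrite scale1r addr0 !(wmod_dE, wmod_xE) mulrCA /decr_coord /incr_coord.
rewrite !set_coord_neq 1?eq_sym //; last by rewrite eq_sym.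
by rewrite set_coordC.
Qed.

Lemma wmod_xx i j v : wmod_x i (wmod_x j v) = wmod_x j (wmod_x i v).
Proof.
have [->//|ij] := eqVneq i j; apply/ffunP => s; rewrite !wmod_xE mulrCA.
rewrite /decr_coord !set_coord_neq //; last by rewrite eq_sym.
by rewrite set_coordC.
Qed.

Lemma wmod_dd i j v : wmod_d i (wmod_d j v) = wmod_d j (wmod_d i v).
Proof.
have [->//|ij] := eqVneq i j; apply/ffunP => s; rewrite !wmod_dE mulrCA.
rewrite /incr_coord !set_coord_neq //; last by rewrite eq_sym.
by rewrite set_coordC.
Qed.

Definition wact : A -> V -> V := qweyl_act wmod_x wmod_d.

HB.instance Definition _ u := GRing.Linear.on (wact u).

Lemma wactD u v w : wact (u + v) w = wact u w + wact v w.
Proof. exact: (qweyl_actDl wmod_dx wmod_xx wmod_dd). Qed.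

Lemma wactZ (c : K) u w : wact (c *: u) w = c *: wact u w.
Proof. exact: (qweyl_actZl wmod_dx wmod_xx wmod_dd). Qed.

Lemma wactM u v w : wact (u * v) w = wact u (wact v w).
Proof. exact: (qweyl_actM wmod_dx wmod_xx wmod_dd). Qed.

Lemma wact1 w : wact 1 w = w.
Proof. exact: (qweyl_act1 wmod_dx wmod_xx wmod_dd). Qed.

Lemma wact_x i w : wact (X i) w = wmod_x i w.
Proof. exact: (qweyl_act_x wmod_dx wmod_xx wmod_dd). Qed.

Lemma wact_d i w : wact (D i) w = wmod_d i w.
Proof. exact: (qweyl_act_d wmod_dx wmod_xx wmod_dd). Qed.

Definition wbasis (s : I) : V := [ffun s' => (s' == s)%:R].

Lemma wbasisE (s s' : I) : wbasis s s' = (s' == s)%:R.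
Proof. by rewrite ffunE. Qed.

Lemma wbasis_sum (v : V) : v = \sum_s v s *: wbasis s.
Proof.
apply/ffunP => s; rewrite sum_ffunE (bigD1 s) //= big1 ?addr0.
  by rewrite !ffunE eqxx [_ *: _]mulr1.
by move=> s' /negPf ss; rewrite !ffunE eq_sym ss [_ *: _]mulr0.
Qed.

Lemma wmod_x_basis i s :
  wmod_x i (wbasis s) = wx_coef i (incr s i i) *: wbasis (incr s i).
Proof.
apply/ffunP => s'; rewrite wmod_xE [RHS]ffunE !wbasisE.
have -> : (s' == incr s i) = (decr s' i == s).
  by apply/eqP/eqP => [->|<-]; rewrite ?incr_coordK ?decr_coordK.
by case: eqP => [<-|_]; rewrite ?decr_coordK ?mulr0 // [in RHS]/GRing.scale /= mulr0.
Qed.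

Lemma wmod_d_basis i s :
  wmod_d i (wbasis s) = wd_coef i (decr s i i) *: wbasis (decr s i).
Proof.
apply/ffunP => s'; rewrite wmod_dE [RHS]ffunE !wbasisE.
have -> : (s' == decr s i) = (incr s' i == s).
  by apply/eqP/eqP => [->|<-]; rewrite ?incr_coordK ?decr_coordK.
by case: eqP => [<-|_]; rewrite ?incr_coordK ?mulr0 // [in RHS]/GRing.scale /= mulr0.
Qed.

Lemma wact_x_set (s : I) i k : (k < l)%N ->
  wact (X i) (wbasis (setc s i k)) =
  (if k.+1 == l then a i else 1) *: wbasis (setc s i k.+1).
Proof.
move=> kl; rewrite wact_x wmod_x_basis incr_coord_set /wx_coef.
by rewrite -incr_coord_set incr_coord_eq0 set_coord_eq modn_small.
Qed.

Lemma wact_d_set (s : I) i k : (k.+1 < l)%N ->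
  wact (D i) (wbasis (setc s i k.+1)) = t i k.+1 *: wbasis (setc s i k).
Proof.
move=> kl; rewrite wact_d wmod_d_basis decr_coord_set /wd_coef.
by rewrite set_coord_eq modn_small ?(ltn_eqF kl) // ltnW.
Qed.

Lemma wact_d_set0 (s : I) i :
  wact (D i) (wbasis (setc s i 0)) = r i *: wbasis (setc s i l.-1).
Proof.
have -> : setc s i 0 = setc s i l.-1.+1.
  by apply: set_coord_mod; rewrite prednK // modnn mod0n.
rewrite wact_d wmod_d_basis decr_coord_set /wd_coef.
by rewrite set_coord_eq modn_small ?prednK // eqxx.
Qed.

Lemma wact_xX_set0 (s : I) i k : (k < l)%N ->
  wact (X i ^+ k) (wbasis (setc s i 0)) = wbasis (setc s i k).
Proof.
elim: k => [|k IH] kl; first by rewrite wact1.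
by rewrite exprS wactM IH ?(ltnW kl) // wact_x_set ?(ltnW kl) // (ltn_eqF kl) scale1r.
Qed.

Lemma wact_xl_set0 (s : I) i :
  wact (X i ^+ l) (wbasis (setc s i 0)) = a i *: wbasis (setc s i 0).
Proof.
rewrite -[l in X i ^+ l](prednK l_gt0) exprS wactM wact_xX_set0 ?prednK //.
rewrite wact_x_set ?prednK // eqxx; congr (_ *: wbasis _).
by apply: set_coord_mod; rewrite modnn mod0n.
Qed.

Lemma wact_dX_set (s : I) i k : (k < l)%N ->
  wact (D i ^+ k) (wbasis (setc s i k)) =
  (\prod_(j < k) t i j.+1) *: wbasis (setc s i 0).
Proof.
elim: k => [|k IH] kl; first by rewrite wact1 big_ord0 scale1r.
rewrite exprSr wactM wact_d_set // linearZ /= IH ?(ltnW kl) // scalerA.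
by rewrite big_ord_recr /= mulrC.
Qed.

(** One full turn downwards: the first step wraps around with coefficient r, and the remaining ones
    contribute the weights l - 1, ..., 1. *)
Lemma wact_dl_set0 (s : I) i :
  wact (D i ^+ l) (wbasis (setc s i 0)) = b i *: wbasis (setc s i 0).
Proof.
have [_ _ rb _] := abP i.
rewrite -[l in D i ^+ l](prednK l_gt0) exprSr wactM wact_d_set0 linearZ /=.
by rewrite wact_dX_set ?prednK // scalerA rb.
Qed.

(** Powers of x_i carry the basis vectors with i-th coordinate 0 to all others, and z commutes with
    these powers. *)
Lemma wact_central i z (c : K) : center z ->
  (forall s, wact z (wbasis (setc s i 0)) = c *: wbasis (setc s i 0)) ->
  forall v, wact z v = c *: v.
Proof.
move=> zZ z0 v; rewrite [v]wbasis_sum linear_sum scaler_sumr; apply: eq_bigr => s _.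
rewrite linearZ /= scalerA mulrC -scalerA; congr (_ *: _).
rewrite -(set_coord_id l_gt0 s i) -wact_xX_set0 // -wactM zZ wactM z0.
by rewrite linearZ.
Qed.

Lemma wact_gens g v : @qweyl_gens K n l q a b g -> wact g v = 0.
Proof.
case=> -[i _ <-]; rewrite -scaleNr wactD wactZ wact1 scaleNr; apply/eqP;
  rewrite subr_eq0; apply/eqP; apply: (@wact_central i) => [|s].
- exact: qweyl_x_expl_center.
- exact: wact_xl_set0.
- exact: qweyl_d_expl_center.
- exact: wact_dl_set0.
Qed.

Lemma ffun_scaleE (c : K) (v : V) s : (c *: v) s = c * v s.
Proof. exact: ffunE. Qed.

Lemma ffun_addE (u v : V) s : (u + v) s = u s + v s.
Proof. exact: ffunE. Qed.

Definition op_img (F : V -> V) := exists u : A, forall v, wact u v = F v.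

Definition diag_img (c : I -> K) := exists u : A, forall v s, wact u v s = c s * v s.

Lemma diag_imgM c d : diag_img c -> diag_img d -> diag_img (fun s => c s * d s).
Proof.
by move=> [u Eu] [w Ew]; exists (u * w) => v s; rewrite wactM Eu Ew mulrA.
Qed.

Lemma diag_img_affine k e c : diag_img c -> diag_img (fun s => k * c s + e).
Proof.
move=> [u Eu]; exists (k *: u + e *: 1) => v s; rewrite wactD !wactZ wact1.
by rewrite ffun_addE !ffun_scaleE Eu mulrDl -mulrA.
Qed.

Lemma diag_img_prod (J : Type) (w : seq J) (F : J -> I -> K) :
  (forall j, diag_img (F j)) -> diag_img (fun s => \prod_(j <- w) F j s).
Proof.
move=> HF; elim: w => [|j w IH].
  by exists 1 => v s; rewrite wact1 big_nil mul1r.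
by have [u Eu] := diag_imgM (HF j) IH; exists u => v s; rewrite Eu big_cons.
Qed.

Lemma diag_img_euler i : diag_img (fun s => mu i * q ^+ s i).
Proof.
exists (qeuler q (X i) (D i)) => v s.
rewrite /qeuler wactD wact1 wactZ wactM wact_x wact_d.
rewrite ffun_addE ffun_scaleE wmod_xdE -(weight_euler hl hq).
by rewrite [RHS]mulrDl mul1r mulrA.
Qed.

(** Lagrange interpolation in u_i, whose eigenvalues mu_i q^j for 0 <= j < l are distinct because
    mu_i is nonzero. *)
Lemma diag_img_coord i (k : 'I_l) : diag_img (fun s => (s i == k)%:R).
Proof.
pose F (j : 'I_l) (s : I) : K := mu i * q ^+ s i + - (mu i * q ^+ j).
have HF j : diag_img (F j).
  have [u Eu] := diag_img_affine 1 (- (mu i * q ^+ j)) (diag_img_euler i).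
  by exists u => v s; rewrite Eu mul1r.
have [mu0 _ _ _] := abP i.
have qinj (j j' : 'I_l) : q ^+ j = q ^+ j' -> j = j'.
  move/eqP; rewrite (eq_prim_root_expr hq) !modn_small // => /eqP jj.
  exact: val_inj.
pose c := \prod_(j <- [seq j <- enum 'I_l | j != k]) (mu i * q ^+ k - mu i * q ^+ j).
have c0 : c != 0.
  rewrite /c big_filter prodf_seq_neq0; apply/allP => j _; apply/implyP => jk.
  rewrite -mulrBr mulf_neq0 // subr_eq0.
  by apply: contraNneq jk => /qinj ->.
have [u Eu] := diag_img_affine c^-1 0 (diag_img_prod [seq j <- enum 'I_l | j != k] HF).
exists u => v s; rewrite Eu addr0; congr (_ * _).
case: (s i =P k) => [sk|/eqP sk].
  rewrite (_ : \prod_(j <- _) _ = c) ?mulVf //.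
  by apply: eq_bigr => j _; rewrite /F sk.
rewrite (bigD1_seq (s i)) /=; last exact/filter_uniq/enum_uniq.
  by rewrite /F subrr mul0r mulr0.
by rewrite mem_filter sk mem_enum.
Qed.

Lemma diag_img_point (s0 : I) : diag_img (fun s => (s == s0)%:R).
Proof.
have [u Eu] := diag_img_prod (enum 'I_n) (fun i => diag_img_coord i (s0 i)).
exists u => v s; rewrite Eu; congr (_ * _).
case: (s =P s0) => [->|/eqP ss]; first by rewrite big1 // => i _; rewrite eqxx.
have [i si] : exists i, s i != s0 i.
  apply/existsP; apply: contraNT ss => /existsPn E.
  by apply/eqP/ffunP => i; have := E i; rewrite negbK => /eqP.
by rewrite (bigD1_seq i) ?mem_enum ?enum_uniq //= (negPf si) mul0r.
Qed.

(** The matrix unit E_s's. *)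
Definition unit_op (s' s : I) (v : V) : V := v s *: wbasis s'.

Definition conn (s' s : I) := op_img (unit_op s' s).

(* E_s's' u E_ss is a multiple of the matrix unit E_s's. *)
Lemma conn_wact u s' s : wact u (wbasis s) s' != 0 -> conn s' s.
Proof.
move=> us; have [w Ew] := diag_img_point s; have [w' Ew'] := diag_img_point s'.
exists ((wact u (wbasis s) s')^-1 *: (w' * u * w)) => v.
have -> : wact ((wact u (wbasis s) s')^-1 *: (w' * u * w)) v =
    (wact u (wbasis s) s')^-1 *: wact w' (wact u (wact w v)).
  by rewrite wactZ !wactM.
have -> : wact w v = v s *: wbasis s.
  apply/ffunP => s1; rewrite Ew ffun_scaleE wbasisE mulrC.
  by case: eqP => [->|_]; rewrite ?mulr0.
rewrite linearZ /=; apply/ffunP => s1.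
rewrite ffun_scaleE Ew' !ffun_scaleE wbasisE.
case: (s1 =P s') => [->|_]; last by rewrite mul0r !mulr0.
by rewrite mul1r mulr1 mulrCA mulVf // mulr1.
Qed.

Lemma conn_trans s1 s2 s3 : conn s1 s2 -> conn s2 s3 -> conn s1 s3.
Proof.
move=> [u Eu] [w Ew]; exists (u * w) => v; rewrite wactM Ew Eu /unit_op.
by rewrite ffun_scaleE wbasisE eqxx mulr1.
Qed.

Lemma conn_refl s : conn s s.
Proof. by apply: (@conn_wact 1); rewrite wact1 wbasisE eqxx oner_neq0. Qed.

Lemma conn_up s i k : (k.+1 < l)%N -> conn (setc s i k.+1) (setc s i k).
Proof.
move=> kl; apply: (@conn_wact (X i)); rewrite wact_x_set ?(ltnW kl) // (ltn_eqF kl).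
by rewrite scale1r wbasisE eqxx oner_neq0.
Qed.

Lemma conn_le s i j k : (j <= k < l)%N -> conn (setc s i k) (setc s i j).
Proof.
move=> /andP[jk]; elim: k jk => [|k IH].
  by rewrite leqn0 => /eqP -> _; apply: conn_refl.
rewrite leq_eqVlt => /orP[/eqP -> _|jk kl]; first exact: conn_refl.
by apply: conn_trans (conn_up _ _ kl) (IH jk (ltnW kl)).
Qed.

(** If a_i = 0, d_i descends to 0 through nonzero weights; otherwise x_i climbs to l - 1 and wraps
    around with the nonzero coefficient a_i. *)
Lemma conn_0 s i k : (k < l)%N -> conn (setc s i 0) (setc s i k).
Proof.
have [_ _ _ t_neq0] := abP i.
have [a0|a0] := eqVneq (a i) 0.
  elim: k => [|k IH] kl; first exact: conn_refl.
  apply: conn_trans (IH (ltnW kl)) _; apply: (@conn_wact (D i)).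
  rewrite wact_d_set // ffun_scaleE wbasisE eqxx mulr1.
  by apply: t_neq0 => //=.
move=> kl; apply: (@conn_trans _ (setc s i l.-1)).
  apply: (@conn_wact (X i)); rewrite wact_x_set ?prednK // eqxx ffun_scaleE wbasisE.
  rewrite (_ : setc s i 0 == _) ?mulr1 //.
  by apply/eqP; apply: set_coord_mod; rewrite modnn mod0n.
by apply: conn_le; rewrite ltn_predL l_gt0 andbT -ltnS prednK.
Qed.

Lemma conn_set s i (k : 'I_l) : conn (setc s i k) s.
Proof.
rewrite -[X in conn _ X](set_coord_id l_gt0 s i).
apply: (@conn_trans _ (setc s i 0)); last exact: conn_0.
by apply: conn_le; rewrite leq0n ltn_ord.
Qed.

Lemma conn_all s' s : conn s' s.
Proof.
(* Coordinates are changed one at a time: [w m] agrees with s' in the first m places and with s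
   elsewhere. *)
pose w (m : nat) : I := [ffun i : 'I_n => if (i < m)%N then s' i else s i].
have -> : s' = w n by apply/ffunP => i; rewrite ffunE ltn_ord.
have: (n <= n)%N by []; elim: {-2}n => [|m IH] mn.
  have -> : w 0%N = s by apply/ffunP => i; rewrite ffunE.
  exact: conn_refl.
apply: conn_trans (IH (ltnW mn)).
have -> : w m.+1 = setc (w m) (Ordinal mn) (s' (Ordinal mn)).
  apply/ffunP => i; rewrite !ffunE ltnS leq_eqVlt.
  case: (i =P Ordinal mn) => [->|/eqP im] /=.
    by rewrite eqxx; apply/val_inj; rewrite /= modn_small.
  by rewrite (negPf (_ : (i : nat) != m)).
exact: conn_set.
Qed.

(** Columns are the images of the basis vectors, so composition becomes the matrix product in the
    same order. *)
Definition wmx (u : A) : 'M[K]_#|{: I}| :=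
  \matrix_(i, j) wact u (wbasis (enum_val j)) (enum_val i).

Lemma wmxD u v : wmx (u + v) = wmx u + wmx v.
Proof. by apply/matrixP => i j; rewrite !mxE wactD ffun_addE. Qed.

Lemma wmxZ (c : K) u : wmx (c *: u) = c *: wmx u.
Proof. by apply/matrixP => i j; rewrite !mxE wactZ ffun_scaleE. Qed.

Lemma wmx1 : wmx 1 = 1%:M.
Proof.
apply/matrixP => i j; rewrite !mxE wact1 wbasisE.
by rewrite (inj_eq enum_val_inj).
Qed.

Lemma wmxM u v : wmx (u * v) = wmx u *m wmx v.
Proof.
apply/matrixP => i j; rewrite !mxE wactM [wact v _]wbasis_sum linear_sum sum_ffunE.
rewrite (reindex_onto enum_val enum_rank) /=; last by move=> s _; apply: enum_rankK.
rewrite (eq_bigl xpredT) => [|k]; last by rewrite enum_valK eqxx.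
by apply: eq_bigr => k _; rewrite !mxE linearZ /= ffun_scaleE mulrC.
Qed.

Lemma wmx_surj B : exists u, wmx u = B.
Proof.
rewrite [B]matrix_sum_delta.
have sumP (J : Type) (w : seq J) (F : J -> 'M[K]_#|{: I}|) :
    (forall j, exists u, wmx u = F j) -> exists u, wmx u = \sum_(j <- w) F j.
  move=> HF; elim: w => [|j w [u Eu]].
    by exists (0 *: 1); rewrite wmxZ scale0r big_nil.
  by have [v Ev] := HF j; exists (v + u); rewrite wmxD Eu Ev big_cons.
apply: (sumP) => i; apply: (sumP) => j.
have [u Eu] := conn_all (enum_val i) (enum_val j).
exists (B i j *: u); rewrite wmxZ; congr (_ *: _); apply/matrixP => i' j'.
rewrite !mxE Eu ffun_scaleE !wbasisE !(inj_eq enum_val_inj) [j == j']eq_sym.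
by rewrite mulrC; case: eqP; case: eqP; rewrite ?mulr1 ?mulr0.
Qed.

Lemma wmx_gen_ideal u :
  gen_ideal (center_gen_ideal (@qweyl_gens K n l q a b)) u -> wmx u = 0.
Proof.
move=> mu0; apply/matrixP => i j; rewrite !mxE.
have -> : wact u (wbasis (enum_val j)) = 0; last by rewrite ffunE.
exact: (qweyl_act_center_gen_ideal wmod_dx wmod_xx wmod_dd _ wact_gens mu0).
Qed.

End WeightModule.

(** A spanning family with at most as many members as the dimension is a basis. *)
Lemma spanning_family_free (K : fieldType) (vT : vectType K) (S : finType)
    (F : S -> vT) (k : S -> K) : (#|S| <= \dim {:vT})%N ->
  (forall v, exists c : S -> K, v = \sum_s c s *: F s) ->
  \sum_s k s *: F s = 0 -> forall s, k s = 0.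
Proof.
move=> Sdim Fspan k0 s.
have szF : size [seq F s | s <- enum S] = #|S| by rewrite size_map -cardE.
have : basis_of fullv [seq F s | s <- enum S].
  rewrite basisEdim szF Sdim andbT; apply/subvP => v _; have [c ->] := Fspan v.
  apply: memv_suml => s' _; apply/memvZ/memv_span/map_f; exact: mem_enum.
move=> /basis_free fr; have /freeP fP : free (Tuple (introT eqP szF)) := fr.
have := fP (fun i => k (enum_val i)).
move=> /(_ _ (enum_rank s)); rewrite enum_rankK; apply.
rewrite -[RHS]k0 [RHS](reindex_onto enum_val enum_rank) /=; last first.
  by move=> s' _; apply: enum_rankK.
rewrite [RHS](eq_bigl xpredT) => [|i]; last by rewrite enum_valK eqxx.
apply: eq_bigr => i _; congr (_ *: _).
by rewrite (nth_map (enum_val i)) -?cardE // -enum_val_nth.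
Qed.

(** * The two implications *)

Section Main.
Variables (K : closedFieldType) (n l : nat) (q : K) (a b : 'I_n -> K).
Hypotheses (hl : (1 < l)%N) (hq : l.-primitive_root q).

Local Notation A := (qweyl n q).
Local Notation m := (center_gen_ideal (@qweyl_gens K n l q a b)).
Local Notation I := {ffun 'I_n -> 'I_l}.

Lemma azumaya_necessary N : (0 < N)%N -> azumaya_locus N m ->
  forall i, a i * b i != (1 - q) ^- l.
Proof.
move=> N0 [_ [f [f_lin [f1 fM] [g gf fg]]]].
pose phi (u : A) := f (quot_pi m u).
have f0 : f 0 = 0 by have := f_lin (-1) 0 0; rewrite !scaleN1r addNr addNr.
apply: (@azumaya_neq K n l N q a b hl hq N0 phi) => [u v|c u||u v|B|u].
- by rewrite /phi quot_piD -[quot_pi _ u]scale1r f_lin !scale1r.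
- by rewrite /phi quot_piZ -[c *: quot_pi _ _]addr0 f_lin f0 addr0.
- by rewrite /phi quot_pi1 f1.
- by rewrite /phi quot_piM fM.
- by exists (repr (g B)); rewrite /phi quot_piK fg.
rewrite /phi; split => [fu|mu].
  rewrite -[u]subr0; apply/quot_pi_eq; rewrite quot_pi0.
  by apply: (can_inj gf); rewrite f0.
by rewrite (_ : quot_pi m u = 0) // -(quot_pi0 m); apply/quot_pi_eq; rewrite subr0.
Qed.

Lemma azumaya_sufficient : (forall i, a i * b i != (1 - q) ^- l) ->
  azumaya_locus #|{: I}| m.
Proof.
move=> ab.
have /choice[mu /choice[r abP]] i := weight_params_exist hl hq (ab i).
pose rho := @wmx K n l q a mu r hl.
have rho0 u : gen_ideal m u -> rho u = 0 := @wmx_gen_ideal _ _ _ _ _ _ _ _ hl hq abP u.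
have rhoD u v : rho (u + v) = rho u + rho v := wmxD hl hq abP u v.
have rhoZ (c : K) u : rho (c *: u) = c *: rho u := wmxZ hl hq abP c u.
have rho1 : rho 1 = 1%:M := wmx1 hl hq abP.
have rhoM u v : rho (u * v) = rho u *m rho v := wmxM hl hq abP u v.
have rhoB u v : rho (u - v) = rho u - rho v.
  by rewrite -[- v]scaleN1r rhoD rhoZ scaleN1r.
have rho_sum (J : Type) (w : seq J) (F : J -> A) :
    rho (\sum_(j <- w) F j) = \sum_(j <- w) rho (F j).
  have rho00 : rho 0 = 0 by rewrite -(scale0r (1 : A)) rhoZ scale0r.
  by elim/big_rec2: _ => // j u v _ <-; rewrite rhoD.
have rho_surj B : exists u, rho u = B := wmx_surj hl hq abP B.
(* The reduced monomials span A modulo (m) and their images span the matrices. By the dimension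
   count these images are independent, so an element of the kernel has all its reduced coefficients
   equal to 0. *)
have rho_ker u : rho u = 0 -> gen_ideal m u.
  move=> u0; have [k mk] := qmon_span_mod a b hl hq u.
  have k0 : forall s, k s = 0.
    apply: (@spanning_family_free _ _ _
      (fun s : {ffun 'I_n + 'I_n -> 'I_l} => rho (qmon q [ffun t => s t : nat]))).
    (* Both counts are l^(2n): exponent vectors below l, and entries of a square matrix of size
       l^n. *)
    - rewrite dimvf /dim /= !card_ffun card_sum !card_ord.
      by rewrite expnD.
    - move=> B; have [v <-] := rho_surj B; have [c mc] := qmon_span_mod a b hl hq v.
      exists c; apply/eqP; rewrite -subr_eq0; apply/eqP; apply: etrans (rho0 _ mc).
      rewrite rhoB.
      by congr (_ - _); rewrite rho_sum; apply: eq_bigr => s _; rewrite rhoZ.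
    have := rho0 _ mk; rewrite rhoB u0 sub0r => /eqP; rewrite oppr_eq0 => /eqP.
    by rewrite rho_sum => E; apply: etrans E; apply: eq_bigr => s _; rewrite rhoZ.
  move: mk; rewrite big1 ?subr0 // => s _.
  by rewrite k0 scale0r.
split.
  (* Maximality needs only that 1 is not in m: [rho] kills m, whereas the identity matrix has a
     diagonal entry 1, taken at the zero index. *)
  apply: (qweyl_ideal_max hl hq) => m1.
  pose i0 := enum_rank ([ffun=> Ordinal (ltnW hl)] : I).
  have := rho0 _ (gen_ideal_incl m1); rewrite rho1 => /matrixP/(_ i0 i0).
  by rewrite !mxE eqxx => /eqP; rewrite oner_eq0.
pose f (w : quot_alg m) := rho (repr w).
have f_pi u : f (quot_pi m u) = rho u.
  apply/eqP; rewrite -subr_eq0 -rhoB; apply/eqP/rho0/quot_pi_eq; exact: quot_piK.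
have f_inj : injective f.
  elim/quot_ind => u; elim/quot_ind => v; rewrite !f_pi => uv.
  by apply/quot_pi_eq/rho_ker; rewrite rhoB uv subrr.
exists f; split.
- move=> c; elim/quot_ind => u; elim/quot_ind => v.
  by rewrite -quot_piZ -quot_piD !f_pi rhoD rhoZ.
- split; first by rewrite -quot_pi1 f_pi rho1.
  by elim/quot_ind => u; elim/quot_ind => v; rewrite -quot_piM !f_pi rhoM.
have /choice[h hK] := rho_surj.
have gf : cancel (fun B => quot_pi m (h B)) f by move=> B; rewrite f_pi hK.
by exists (fun B => quot_pi m (h B)) => // w; apply: f_inj; rewrite gf.
Qed.

End Main.

Theorem proposition2p3 (R : realType) (n l : nat) (q : R[i])
    (a b : 'I_n -> R[i]) (hn : (1 <= n)%N) (hl : (1 < l)%N) (hq0 : q != 0)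
    (hq : l.-primitive_root q) :
  azumaya_locus (l ^ n)%N
    (center_gen_ideal
       (range (fun i => qweyl_x q i ^+ l - (a i)%:A) `|`
        range (fun i => qweyl_d q i ^+ l - (b i)%:A))) <->
  (forall i : 'I_n, a i * b i != (1 - q) ^- l).
Proof.
split; first by apply: azumaya_necessary => //; rewrite expn_gt0 ltnW.
have -> : (l ^ n)%N = #|{: {ffun 'I_n -> 'I_l}}| by rewrite card_ffun !card_ord.
exact: azumaya_sufficient.
Qed.
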